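(* Let $M_{n,k,m}=\sum_{\alpha=1}^m\tau_\alpha Y_\alpha Y_\alpha^*$ be the random $n^k\times n^k$ Hermitian matrix defined in the context, with $|\xi_1|=1$. Suppose that for all $q\in\mathbb N$, $$\frac1m\sum_{j=1}^m\tau_j^q\to m_q^{(\tau)},\qquad m\to+\infty,$$ for some numbers $m_q^{(\tau)}\in\mathbb R$. Assume that $m,n,k$ tend to infinity in such a way that $m/n^k\to c$ for some constant $c\in(0,\infty)$. Then for any fixed integer $p\ge1$, $$\lim_{n,k\to+\infty}\frac1{n^k}\,\mathbb E\big[\mathrm{Tr}\,M_{n,k,m}^p\big]=\sum_{s=1}^p c^s\sum_{\alpha\in\mathcal C_{s,p}^{(1)}}\left(\prod_{t=1}^s m^{(\tau)}_{\deg_t(\alpha)}\right).$$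
   Context: **Matrix model.** Let $\xi_1,\dots,\xi_n$ be i.i.d. complex-valued centered random variables with unit variance (the law of $\xi_1$ does not depend on $n$), and let $\mathbf y=\frac1{\sqrt n}(\xi_1,\dots,\xi_n)\in\mathbb C^n$. Let $\{\mathbf y_\alpha^{(l)}:1\le\alpha\le m,\,1\le l\le k\}$ be i.i.d. copies of $\mathbf y$, and let $Y_\alpha=\mathbf y_\alpha^{(1)}\otimes\cdots\otimes\mathbf y_\alpha^{(k)}$, viewed as an $n^k$-dimensional column vector. Let $(\tau_1,\tau_2,\dots)$ be a fixed sequence of real numbers, and $M_{n,k,m}=\sum_{\alpha=1}^m\tau_\alpha Y_\alpha Y_\alpha^*$, where $^*$ is conjugate transpose. The hypothesis $|\xi_1|=1$ means almost surely. Here $m$ depends on $n,k$. **Sequences.** Write $[s]=\{1,\dots,s\}$. A sequence $\alpha=(\alpha_1,\dots,\alpha_p)$ of positive integers is canonical if $\alpha_1=1$ and $\alpha_u\le\max\{\alpha_1,\dots,\alpha_{u-1}\}+1$ for $u\ge2$. $\mathcal C_{s,p}$ is the set of canonical sequences of length $p$ with exactly $s$ distinct values (the set of values is then $[s]$). $\deg_t(\alpha)=\#\{j\in[p]:\alpha_j=t\}$. **Graphs.** For sequences $\alpha=(\alpha_1,\dots,\alpha_p)$ and $i=(i^{(1)},\dots,i^{(p)})$, with the convention $\alpha_{p+1}=\alpha_1$, $g(i,\alpha)$ is the directed bipartite multigraph whose vertices are the distinct values of $\alpha$ (''$\alpha$-vertices'', placed on one line) and the distinct values of $i$ (''$i$-vertices'',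 placed on another line; an $\alpha$-vertex and an $i$-vertex are always different vertices even if they have the same numerical value), with $p$ down edges $\alpha_u\to i^{(u)}$ and $p$ up edges $i^{(u)}\to\alpha_{u+1}$, $1\le u\le p$, counted with multiplicity. Two edges coincide if they join the same two vertices, irrespective of orientation. $g(i,\alpha)$ is a $\Delta_1(p,s;\alpha)$-graph (where $s$ is the number of distinct values of $\alpha$) if each down edge coincides with exactly one up edge and, after gluing each pair of coincident edges and removing orientation, the resulting graph is a tree with $p$ edges and $p+1$ vertices. $\mathcal C_{s,p}^{(1)}$ is the set of $\alpha\in\mathcal C_{s,p}$ for which there exists $i\in\mathcal C_{p+1-s,p}$ such that $g(i,\alpha)$ is a $\Delta_1(p,s;\alpha)$-graph. *)

(* Defs.v *)
From HB Require Import structures.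
From mathcomp Require Import all_boot all_order all_algebra.
From mathcomp Require Import all_classical all_reals all_analysis.
From mathcomp Require Export complex.
From mathcomp Require Import spectral mxtens.

Set Implicit Arguments.
Unset Strict Implicit.
Unset Printing Implicit Defensive.

Import Order.TTheory GRing.Theory Num.Theory.
Import numFieldNormedType.Exports.

Local Open Scope classical_set_scope.
Local Open Scope complex_scope.
Local Open Scope sesquilinear_scope.
Local Open Scope ring_scope.

Definition complex_pair {R : realType} (z : R[i]) : R * R :=
  (complex.Re z, complex.Im z).

Section ComplexRandomVariables.
Context {d : measure_display} {T : measurableType d} {R : realType}.
Variable P : probability T R.
Implicit Types Z : T -> R[i].

(* C is given the Borel sigma-algebra of R * R. *)
Definition complex_RV Z : Prop :=
  measurable_fun [set: T] (complex_pair \o Z).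

(* Meaningful when Re Z and Im Z are integrable: [fine] sends infinities to 0. *)
Definition complex_expectation Z : R[i] :=
  fine ('E_P[fun w => complex.Re (Z w)])
    +i* fine ('E_P[fun w => complex.Im (Z w)]).

Definition complex_variance Z : R[i] :=
  complex_expectation (fun w => `|Z w - complex_expectation Z| ^+ 2).

Definition mutually_independent (J : finType) (Z : J -> T -> R[i]) : Prop :=
  forall B : J -> set (R * R), (forall j, measurable (B j)) ->
    P [set w | forall j, B j (complex_pair (Z j w))] =
    (\prod_(j : J) P [set w | B j (complex_pair (Z j w))])%E.

End ComplexRandomVariables.

Definition same_law {R : realType} {d d' : measure_display}
    {T : measurableType d} {T' : measurableType d'}
    (P : probability T R) (Z : T -> R[i])
    (P' : probability T' R) (Z' : T' -> R[i]) : Prop :=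
  forall B : set (R * R), measurable B ->
    P [set w | B (complex_pair (Z w))] = P' [set w | B (complex_pair (Z' w))].

(* The recursion starts at k = 1 because n ^ k.+2 is convertible to
   n * n ^ k.+1, whereas n ^ 1 is n and not n * n ^ 0. *)
Fixpoint tensor_rec {C : pzRingType} {n k : nat} :
    ('I_k.+1 -> 'cV[C]_n) -> 'cV[C]_(n ^ k.+1) :=
  match k return ('I_k.+1 -> 'cV[C]_n) -> 'cV[C]_(n ^ k.+1) with
  | 0 => fun y => y ord0
  | k'.+1 => fun y => y ord0 *t tensor_rec (fun l => y (lift ord0 l))
  end.

Definition tensor {C : pzRingType} {n k : nat} :
    ('I_k -> 'cV[C]_n) -> 'cV[C]_(n ^ k) :=
  match k return ('I_k -> 'cV[C]_n) -> 'cV[C]_(n ^ k) with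
  | 0 => fun _ => const_mx 1
  | k'.+1 => fun y => tensor_rec y
  end.

Section MatrixModel.
Context {R : realType} {n k m : nat}.
Variables (tau : nat -> R) (x : 'I_m -> 'I_k -> 'I_n -> R[i]).

Definition tensor_factor (a : 'I_m) (l : 'I_k) : 'cV[R[i]]_n :=
  ((Num.sqrt n%:R)^-1)%:C *: \col_(j < n) x a l j.

Definition tensor_vector (a : 'I_m) : 'cV[R[i]]_(n ^ k) :=
  tensor (tensor_factor a).

(* The informal tau_(j+1) is [tau j]. *)
Definition tensor_matrix : 'M[R[i]]_(n ^ k) :=
  \sum_(a < m) (tau a)%:C *: (tensor_vector a *m (tensor_vector a)^t*).

End MatrixModel.

(* A sequence of length p is a p.-tuple; position u of 'I_p is the informal
   position u + 1. *)
Definition canonical_seq (p : nat) (a : p.-tuple nat) : Prop :=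
  [/\ forall u : 'I_p, (0 < tnth a u)%N,
      forall u : 'I_p, u = 0%N :> nat -> tnth a u = 1%N
    & forall u : 'I_p, (0 < u)%N ->
        (tnth a u <= (\max_(v < p | (v < u)%N) tnth a v).+1)%N].

Definition nb_values (p : nat) (a : p.-tuple nat) : nat := size (undup a).

Definition canonical_seqs (s p : nat) : set (p.-tuple nat) :=
  [set a | canonical_seq a /\ nb_values a = s].
Arguments canonical_seqs : clear implicits.

Definition deg (p : nat) (a : p.-tuple nat) (t : nat) : nat := count_mem t a.

Definition is_tree (V : finType) (e : rel V) : Prop :=
  [/\ (0 < #|V|)%N, forall x, ~~ e x x, symmetric e,
      forall x y : V, connect e x y
    & forall c : seq V, (2 < size c)%N -> ~~ ucycleb e c].

Definition edge_set (V : finType) (e : rel V) : {set {set V}} :=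
  [set A : {set V} | [exists x, exists y, e x y && (A == [set x; y])]]%SET.

Section BipartiteGraph.
Context {p : nat}.
Variables i a : p.-tuple nat.

(* inl: alpha-vertices, inr: i-vertices. *)
Definition vertices : seq (nat + nat) := undup (map inl a ++ map inr i).

Definition down_edge (u : 'I_p) : (nat + nat) * (nat + nat) :=
  (inl (tnth a u), inr (tnth i u)).

(* [ordS] is the cyclic successor: it implements alpha_(p+1) = alpha_1. *)
Definition up_edge (u : 'I_p) : (nat + nat) * (nat + nat) :=
  (inr (tnth i u), inl (tnth a (ordS u))).

Definition coincide (e f : (nat + nat) * (nat + nat)) : bool :=
  (e == f) || (e == (f.2, f.1)).

(* The unoriented simple graph obtained by gluing coincident edges. *)
Definition glued : rel (seq_sub vertices) := fun x y =>
  [exists u : 'I_p, coincide (down_edge u) (val x, val y)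
                    || coincide (up_edge u) (val x, val y)].

Definition Delta1_graph (s : nat) : Prop :=
  [/\ nb_values a = s,
      forall u : 'I_p, #|[set v : 'I_p | coincide (down_edge u) (up_edge v)]%SET| = 1%N,
      is_tree glued, #|edge_set glued| = p & #|{: seq_sub vertices}| = p.+1].

End BipartiteGraph.

Definition canonical_seqs1 (s p : nat) : set (p.-tuple nat) :=
  [set a | canonical_seqs s p a /\
    exists2 i : p.-tuple nat, canonical_seqs (p.+1 - s) p i & Delta1_graph i a s].
Arguments canonical_seqs1 : clear implicits.

(* Hence the \sum_(a \in canonical_seqs1 s p) of fsbigop is a genuine finite
   sum and not its default value 0. *)
Lemma finite_canonical_seqs1 (s p : nat) : finite_set (canonical_seqs1 s p).
Proof.
have val_le (a : p.-tuple nat) : canonical_seq a -> forall u : 'I_p, (tnth a u < p.+1)%N.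
  case=> _ a1 ac u; rewrite ltnS; apply: (@leq_trans u.+1); last exact: ltn_ord.
  have [N] := ubnP (u : nat); elim: N u => // N IH u uN.
  have [u0|u0] := posnP u; first by rewrite (a1 u u0).
  apply: leq_trans (ac u u0) _; rewrite ltnS; apply/bigmax_leqP => v vu.
  by apply: (leq_trans (IH v _) vu); apply: (leq_trans vu).
pose f (b : p.-tuple 'I_p.+1) : p.-tuple nat := map_tuple val b.
apply: (@sub_finite_set _ _ (f @` [set: p.-tuple 'I_p.+1])).
  move=> a [[ca _] _]; exists [tuple inord (tnth a u) | u < p] => //.
  apply: eq_from_tnth => u; rewrite tnth_map tnth_mktuple.
  exact: inordK (val_le a ca u).
exact/finite_image/finite_finset.
Qed.

(* Main.v *)
Require Import Defs.
From mathcomp Require Import all_boot all_order all_algebra.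
From mathcomp Require Import all_classical all_reals all_analysis.
From mathcomp Require Import complex.
From mathcomp Require Import measurable_realfun spectral mxtens.
From mathcomp Require Import ring lra zify.

Set Implicit Arguments.
Unset Strict Implicit.
Unset Printing Implicit Defensive.

Import Order.TTheory GRing.Theory Num.Theory.
Import numFieldNormedType.Exports.

(** Write f for a choice of indices alpha_1, ..., alpha_p in [m] and io for a
    choice of coordinates i_1, ..., i_p in [n].  Since Y_alpha is a tensor
    product, the inner products <Y_alpha, Y_beta> are products over the k
    factors, and expanding the trace over closed paths gives
      E Tr M^p = sum_f (prod_u tau (f u)) * (n^-p W f)^k,
      W f = sum_io weight f io,
    where weight f io is the product over all entries xi_(a,j) of the mixed
    moments E [conj xi^x xi^y], x and y being the numbers of down and up edges
    joining a to j ([trace_tensor_matrix], [expectation_trace]).  The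
    factorization over the entries uses independence, which is stated for
    events only: [expectation_prod_indep] passes to bounded Borel functions by
    approximating them uniformly by finite sums of indicators.  As |xi| = 1, a
    mixed moment depends only on y - x, is 1 for y = x and vanishes for
    |y - x| = 1.

    Let s be the number of values of f.  If the weight of io is not zero, no
    glued edge is traversed exactly once, so that there are at most p glued
    edges and, by connectedness, s + #(values of io) <= p + 1; equality forces
    a Delta_1-graph ([nb_values_le_of_no_single_edge]).

    - If no Delta_1-graph lies over f, at most p^p n^(p-s) choices io
      contribute, and n^(s-1) n^-p |W f| <= p^p / n ([norm_sum_weight_le]).
      This tends to 0, and so does its k-th power.
    - If some i0 gives a Delta_1-graph over f, then W f = n^(p+1-s) exactly:
      the weight of io is 1 when io is constant wherever i0 is, and 0
      otherwise ([sum_weight_paired_tree]).  Exactness matters, because a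
      relative error, however small, would be raised to the power k while
      nothing relates k to n.

    All the statements about trees rest on one fact: in a tree, a nonempty set
    of edges has a vertex lying on exactly one of them
    ([leafless_subgraph_of_tree]).  It shows that down and up edges pair off,
    that the glued graph has no cycle, and that the weight vanishes unless io
    respects i0 (the edges across which io changes would otherwise contain no
    leaf).

    It remains to sum over the f with a given canonical form b: these are the
    injections of the s values into [m], and m^-s times the sum of the products
    of tau over injections tends to the product of the moments, collisions
    costing a factor 1/m ([cvg_injective_sum]).  The factor (m / n^k)^s
    produces c^s. *)

(** * Leafless edge sets in connected graphs *)

Section ConnectedGraphs.
Variables (V : finType) (e : rel V).
Hypothesis e_sym : symmetric e.
Hypothesis e_conn : forall x y, connect e x y.

Lemma crossing_edge (S : {set V}) x y :
  x \in S -> y \notin S -> exists u v, [/\ u \in S, v \notin S & e u v].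
Proof.
move=> xS yS; have /connectP[q qp yE] := e_conn x y.
elim: q x xS qp yE => [|z q IH] x xS /=; first by move=> _ yE; rewrite yE xS in yS.
case/andP=> exz qp yE; have [zS|zS] := boolP (z \in S); first exact: (IH z).
by exists x, z.
Qed.

(** Growing [S] to the whole vertex set one crossing edge at a time: each step
    absorbs a vertex and makes at least one edge, counted in both orientations,
    internal to [S].  With a singleton [S] this is the inequality between
    vertices and edges of a connected graph. *)
Lemma card_setC_le_edges (S : {set V}) : S != finset.set0 ->
  (#|~: S|.*2 <= #|[set q : V * V | e q.1 q.2 && ~~ ((q.1 \in S) && (q.2 \in S))]|)%N.
Proof.
have [N] := ubnP #|~: S|; elim: N S => // N IH S SN S0.
have [/eqP/cards0_eq ->|] := boolP (#|~: S| == 0%N); first by rewrite cards0.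
rewrite cards_eq0 => /finset.set0Pn[y]; rewrite inE => yS.
have /finset.set0Pn[x xS] := S0.
have [u [v [uS vS euv]]] := crossing_edge xS yS.
have vC : v \in ~: S by rewrite inE.
have CE : ~: (v |: S) = ~: S :\ v by apply/setP => z; rewrite !inE negb_or.
have cC : #|~: S| = #|~: (v |: S)|.+1 by rewrite CE (cardsD1 v (~: S)) vC.
have := IH (v |: S); rewrite -cC => /(_ (SN : _)) /=.
have -> : v |: S != finset.set0 by apply/finset.set0Pn; exists v; rewrite !inE eqxx.
move=> /(_ isT) le1; rewrite cC doubleS.
set E1 := [set q | _] in le1 *; set E2 := [set q | _].
have uv : u != v by apply: contraNneq vS => <-.
have -> : E2 = (u, v) |: ((v, u) |: (E2 :\ (u, v) :\ (v, u))).
  apply/setP => -[a b]; rewrite !inE /= !xpair_eqE.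
  have [/andP[/eqP-> /eqP->]|_] := boolP ((a == u) && (b == v)).
    by rewrite euv (negPf vS) andbF.
  have [/andP[/eqP-> /eqP->]|_] := boolP ((a == v) && (b == u)) => //=.
  by rewrite e_sym euv (negPf vS).
rewrite cardsU1 cardsU1 !inE /= !xpair_eqE ?eqxx ?(negPf uv) /= !add1n !ltnS.
apply: (leq_trans le1); apply/subset_leq_card/fintype.subsetP => -[a b].
rewrite !inE /= !xpair_eqE => /andP[-> H] /=.
apply/and3P; split; apply: contraNN H.
- by case/andP=> /eqP-> /eqP->; rewrite eqxx uS orbT.
- by case/andP=> /eqP-> /eqP->; rewrite eqxx uS orbT.
- by case/andP=> -> ->; rewrite !orbT.
Qed.

(** A leafless [b] touching a vertex set [S] has at least [#|S|] edges, all
    inside [S], and [card_setC_le_edges] provides [#|~: S|] further edges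
    outside: too many for a tree.  The tree condition is the strict bound on the
    number of ordered edges. *)
Lemma leafless_subgraph_of_tree (b : rel V) :
    (#|[set q : V * V | e q.1 q.2]| < #|V|.*2)%N ->
    symmetric b -> subrel b e ->
    (forall x y, b x y -> exists2 z, z != y & b x z) ->
  forall x y, ~~ b x y.
Proof.
move=> tree b_sym be leafless x y; apply/negP => bxy.
pose S := [set z | [exists t, b z t]].
have S0 : S != finset.set0 by apply/finset.set0Pn; exists x; rewrite inE; apply/existsP; exists y.
have := card_setC_le_edges S0; set E1 := [set q | _] => le1.
have le2 : (#|S|.*2 <= #|[set q : V * V | b q.1 q.2]|)%N.
  have -> : #|[set q : V * V | b q.1 q.2]| = (\sum_z \sum_(t | b z t) 1)%N.
    by rewrite pair_big_dep /= sum1dep_card.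
  rewrite -muln2 -sum_nat_const big_mkcond /=; apply: leq_sum => z _.
  case: ifP => //; rewrite inE => /existsP[t bzt].
  have [t' t't bzt'] := leafless _ _ bzt.
  by rewrite (bigD1 t) //= (bigD1 t') //= bzt' t't.
have : (#|E1| + #|[set q : V * V | b q.1 q.2]| <= #|[set q : V * V | e q.1 q.2]|)%N.
  rewrite -cardsUI [X in (_ + X)%N](_ : _ = 0%N) ?addn0; last first.
    apply/eqP; rewrite cards_eq0 -finset.subset0; apply/fintype.subsetP => -[s t].
    rewrite !inE /= => /andP[/andP[_ +] bst].
    rewrite negb_and => /orP[] /existsP[]; first by exists t.
    by exists s; rewrite b_sym.
  apply/subset_leq_card/fintype.subsetP => -[s t]; rewrite !inE /=.
  by case/orP=> [/andP[]|/be].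
have := cardsC S; lia.
Qed.

(** The edges of a cycle of length at least 3 form a leafless set. *)
Lemma tree_acyclic (c : seq V) :
  (#|[set q : V * V | e q.1 q.2]| < #|V|.*2)%N -> (2 < size c)%N -> ~~ ucycleb e c.
Proof.
move=> tree c2; apply/negP => /andP[ce cU].
pose b x y := (x \in c) && (y \in c) && ((y == next c x) || (x == next c y)).
have b_sym : symmetric b.
  by move=> x y; rewrite /b [(x \in c) && _]andbC orbC.
have be : subrel b e.
  move=> x y /andP[/andP[xc yc] /orP[/eqP->|/eqP->]]; first exact: next_cycle.
  by rewrite e_sym; apply: next_cycle.
have next_neq_prev x : x \in c -> next c x != prev c x.
  move=> xc; apply/eqP => np.
  have nnx : next c (next c x) = x by rewrite np path.next_prev.
  have := orbit_uniq (next c) x; rewrite /orbit.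
  rewrite (order_cycle (cycle_next cU) cU xc).
  by case: (size c) c2 => [|[|[|l]]] //= _; rewrite nnx !inE eqxx orbT.
have [x xc] : exists x, x \in c by case: (c) c2 => // x s _; exists x; rewrite mem_head.
have bx : b x (next c x) by rewrite /b mem_next xc eqxx.
have := leafless_subgraph_of_tree tree b_sym be.
suff H y z : b y z -> exists2 t, t != z & b y t by move=> /(_ H x (next c x)); rewrite bx.
move=> /andP[/andP[yc zc] /orP[/eqP->|/eqP yE]].
  exists (prev c y); first by rewrite eq_sym next_neq_prev.
  by rewrite /b mem_prev yc path.next_prev // eqxx orbT.
exists (next c y); last by rewrite /b mem_next yc eqxx.
have -> : z = prev c y by rewrite yE prev_next.
exact: next_neq_prev.
Qed.

End ConnectedGraphs.

(** * The glued bipartite graph *)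

Section GluedGraph.
Variable p : nat.
Implicit Types i a : p.-tuple nat.

(** Both kinds of edges are recorded as pairs (alpha-vertex, i-vertex), without
    their orientation, so that coincident edges become equal pairs. *)
Definition down_pairs i a := [seq (tnth a u, tnth i u) | u <- enum 'I_p].
Definition up_pairs i a := [seq (tnth a (ordS u), tnth i u) | u <- enum 'I_p].
Definition pairs i a := down_pairs i a ++ up_pairs i a.

Lemma down_pairsP i a e :
  reflect (exists u, e = (tnth a u, tnth i u)) (e \in down_pairs i a).
Proof.
apply: (iffP mapP) => [[u _ ->]|[u ->]]; first by exists u.
by exists u => //; rewrite mem_enum.
Qed.

Lemma up_pairsP i a e :
  reflect (exists u, e = (tnth a (ordS u), tnth i u)) (e \in up_pairs i a).
Proof.
apply: (iffP mapP) => [[u _ ->]|[u ->]]; first by exists u.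
by exists u => //; rewrite mem_enum.
Qed.

Lemma size_down_pairs i a : size (down_pairs i a) = p.
Proof. exact: etrans (size_map _ _) (size_enum_ord p). Qed.

Lemma size_up_pairs i a : size (up_pairs i a) = p.
Proof. exact: etrans (size_map _ _) (size_enum_ord p). Qed.

Lemma size_pairs i a : size (pairs i a) = p.*2.
Proof. by rewrite size_cat size_down_pairs size_up_pairs addnn. Qed.

Lemma vertex_a_proof i a u : inl (tnth a u) \in vertices i a.
Proof. by rewrite mem_undup mem_cat map_f // mem_tnth. Qed.

Lemma vertex_i_proof i a u : inr (tnth i u) \in vertices i a.
Proof. by rewrite mem_undup mem_cat orbC map_f // mem_tnth. Qed.

Definition vertex_a i a u : seq_sub (vertices i a) := SeqSub (vertex_a_proof i a u).
Definition vertex_i i a u : seq_sub (vertices i a) := SeqSub (vertex_i_proof i a u).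

Lemma gluedE i a (x y : seq_sub (vertices i a)) : glued x y =
  match val x, val y with
  | inl s, inr t => (s, t) \in pairs i a
  | inr t, inl s => (s, t) \in pairs i a
  | _, _ => false
  end.
Proof.
apply/idP/idP => [/existsP[u]|].
  have Hd : (tnth a u, tnth i u) \in pairs i a.
    by rewrite mem_cat; apply/orP; left; apply/down_pairsP; exists u.
  have Hu : (tnth a (ordS u), tnth i u) \in pairs i a.
    by rewrite mem_cat; apply/orP; right; apply/up_pairsP; exists u.
  case: (val x) (val y) => [s|t] [s'|t']; rewrite /coincide /down_edge /up_edge /=;
   rewrite !xpair_eqE //= ?orbF.
  - by case/orP=> /andP[].
  - by case/orP=> /andP[/eqP[<-] /eqP[<-]].
  - by case/orP=> /andP[/eqP[<-] /eqP[<-]].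
  - by case/orP=> /andP[].
rewrite /glued; case: (val x) (val y) => [s|t] [s'|t'] //; rewrite mem_cat.
- case/orP=> [/down_pairsP|/up_pairsP] [u [-> ->]]; apply/existsP; exists u.
  + by rewrite /coincide eqxx.
  + by rewrite /coincide /= !eqxx ?orbT.
- case/orP=> [/down_pairsP|/up_pairsP] [u [-> ->]]; apply/existsP; exists u.
  + by rewrite /coincide /= !eqxx ?orbT.
  + by rewrite /coincide /= !eqxx ?orbT.
Qed.

Lemma glued_sym i a : symmetric (@glued p i a).
Proof. by move=> x y; rewrite !gluedE; case: (val x) (val y) => [s|s] [t|t]. Qed.

Lemma glued_down i a u : glued (vertex_a i a u) (vertex_i i a u).
Proof. by rewrite gluedE /= mem_cat; apply/orP; left; apply/down_pairsP; exists u. Qed.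

Lemma glued_up i a u : glued (vertex_i i a u) (vertex_a i a (ordS u)).
Proof. by rewrite gluedE /= mem_cat; apply/orP; right; apply/up_pairsP; exists u. Qed.

Lemma vertexP i a (x : seq_sub (vertices i a)) :
  exists u, x = vertex_a i a u \/ x = vertex_i i a u.
Proof.
have := valP x; rewrite mem_undup mem_cat.
by case/orP=> /mapP[s /tnthP[u ->] xE]; exists u; [left|right]; apply: val_inj.
Qed.

Lemma glued_connect i a (x y : seq_sub (vertices i a)) : connect (@glued p i a) x y.
Proof.
have cs : connect_sym (@glued p i a) by apply: sym_connect_sym; apply: glued_sym.
have [p0|p_gt0] := posnP p.
  by have [[u up] _] := vertexP x; exfalso; move: (up); rewrite p0.
pose o : 'I_p := Ordinal p_gt0.
have C u : connect (@glued p i a) (vertex_a i a o) (vertex_a i a u).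
  case: u => u; elim: u => [|u IH] up.
    by rewrite (_ : Ordinal up = o) //; apply: val_inj.
  have up' := ltnW up; apply: connect_trans (IH up') _.
  apply: (connect_trans (connect1 (glued_down _ _ _))).
  apply: (connect_trans (connect1 (glued_up _ _ _))).
  rewrite (_ : ordS _ = Ordinal up) //; apply: val_inj => /=.
  by rewrite modn_small.
have C' z : connect (@glued p i a) (vertex_a i a o) z.
  have [u [->|->]] := vertexP z; first exact: C.
  by apply: (connect_trans (C u)); apply/connect1/glued_down.
by apply: connect_trans (C' y); rewrite cs.
Qed.

Lemma card_vertices i a :
  #|{: seq_sub (vertices i a)}| = (nb_values a + nb_values i)%N.
Proof.
rewrite card_seq_sub ?undup_uniq // /vertices undup_cat size_cat.
rewrite (eq_in_filter (a2 := xpredT)) ?filter_predT; last first.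
  move=> x; rewrite mem_undup => /mapP[s _ ->]; apply/negP => /mapP[t _]; discriminate.
by rewrite !undup_map_inj ?size_map //; [move=> s t []|move=> s t []].
Qed.

Lemma card_glued_le i a :
  (#|[set q : seq_sub (vertices i a) * seq_sub (vertices i a) | glued q.1 q.2]|
    <= (size (undup (pairs i a))).*2)%N.
Proof.
set A := [set q | _]%SET; set U := undup _.
pose f (q : seq_sub (vertices i a) * seq_sub (vertices i a)) : bool * (nat * nat) :=
  match val q.1, val q.2 with
  | inl s, inr t => (true, (s, t))
  | inr t, inl s => (false, (s, t))
  | _, _ => (true, (0, 0))
  end.
have -> : (size U).*2 = size ([seq (true, e) | e <- U] ++ [seq (false, e) | e <- U]).
  by rewrite size_cat !size_map addnn.
rewrite cardE -(size_map f); apply: uniq_leq_size.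
  rewrite map_inj_in_uniq ?enum_uniq // => -[x y] [x' y'].
  rewrite !mem_enum !inE /= !gluedE /f /=.
  case Ex: (\val x) => [s|s]; case Ey: (\val y) => [t|t] //= _;
  case Ex': (\val x') => [s'|s']; case Ey': (\val y') => [t'|t'] //= _ [E1 E2];
  by congr (_, _); apply: val_inj; rewrite ?Ex ?Ex' ?Ey ?Ey' ?E1 ?E2.
move=> b /mapP[[x y]]; rewrite mem_enum inE /= gluedE /f /=.
by case: (val x) (val y) => [s|s] [t|t] //= st ->; rewrite mem_cat !map_f ?orbT // mem_undup.
Qed.

Lemma nb_values_le_pairs i a : (0 < p)%N ->
  (nb_values a + nb_values i <= (size (undup (pairs i a))).+1)%N.
Proof.
move=> p0; rewrite -card_vertices.
pose x : seq_sub (vertices i a) := vertex_a i a (Ordinal p0).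
have := @card_setC_le_edges _ _ (@glued_sym i a) (@glued_connect i a) [set x].
have -> : [set x] != finset.set0 by apply/finset.set0Pn; exists x; rewrite inE.
move=> /(_ isT) le1; have := cardsC [set x]; rewrite cards1 => <-.
rewrite add1n ltnS -leq_double; apply: leq_trans le1 (leq_trans _ (card_glued_le i a)).
by apply/subset_leq_card/fintype.subsetP => q; rewrite !inE => /andP[].
Qed.

End GluedGraph.

(** * Edge multiplicities and Delta_1-graphs *)

Section Counting.
Variable X : eqType.
Implicit Types s t : seq X.

Lemma eq_count_in (P : pred X) s t :
  (forall e, P e -> count_mem e s = count_mem e t) -> count P s = count P t.
Proof.
move=> st; rewrite -!size_filter; apply/perm_size/allP => e _ /=.
rewrite !count_filter; apply/eqP.
have [Pe|Pe] := boolP (P e).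
  rewrite (eq_count (a2 := pred1 e)) ?st //; last first.
    by move=> x /=; apply: andb_idr => /eqP->.
  by apply: eq_count => x /=; apply/esym/andb_idr => /eqP->.
by rewrite !(eq_count (a2 := pred0)) ?count_pred0 // => x /=;
  apply/negP => /andP[/eqP-> ]; rewrite (negPf Pe).
Qed.

Lemma size_sum_count s : size s = (\sum_(e <- undup s) count_mem e s)%N.
Proof.
rewrite -sum1_size -big_undup_iterop_count; apply: eq_bigr => e _.
by elim: (count_mem e s) => [|[|n] IH] //=; rewrite -IH.
Qed.

Lemma leq_muln_size_sum k s (F : X -> nat) : {in s, forall e, (k <= F e)%N} ->
  (size s * k <= \sum_(e <- s) F e)%N.
Proof.
elim: s => [|x s IH] kF; first by rewrite big_nil.
rewrite big_cons mulSn leq_add ?kF ?mem_head // IH // => e es.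
by rewrite kF // inE es orbT.
Qed.

Lemma eq_sum_muln_size k s (F : X -> nat) : {in s, forall e, (k <= F e)%N} ->
  (\sum_(e <- s) F e <= size s * k)%N -> {in s, forall e, F e = k}.
Proof.
elim: s => [|x s IH] kF //; rewrite big_cons mulSn => le e.
have kx := kF x (mem_head x s).
have ks : {in s, forall e, (k <= F e)%N} by move=> f fs; rewrite kF // inE fs orbT.
have := leq_muln_size_sum ks => le'.
rewrite inE => /orP[/eqP->|].
  apply/eqP; rewrite eqn_leq kx andbT -(leq_add2r (size s * k)).
  by apply: leq_trans le; rewrite leq_add2l.
by apply: IH => //; rewrite -(leq_add2l k); apply: leq_trans le; rewrite leq_add2r.
Qed.

End Counting.

Section Trees.
Variable p : nat.
Hypothesis p_gt0 : (0 < p)%N.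
Implicit Types i a : p.-tuple nat.

(** [leafless_subgraph_of_tree] for the glued graph, with edge sets given as
    predicates on pairs of vertex labels. *)
Lemma leafless_pairs i a (bad : pred (nat * nat)) :
    (size (undup (pairs i a)) < nb_values a + nb_values i)%N ->
    {subset bad <= pairs i a} ->
    (forall x y, bad (x, y) -> exists2 y', y' != y & bad (x, y')) ->
    (forall x y, bad (x, y) -> exists2 x', x' != x & bad (x', y)) ->
  forall e, ~~ bad e.
Proof.
move=> tree badP bada badi [x y]; apply/negP => bxy.
pose b (v w : seq_sub (vertices i a)) := match val v, val w with
  | inl s, inr t => bad (s, t) | inr t, inl s => bad (s, t) | _, _ => false end.
have b_sym : symmetric b.
  by move=> v w; rewrite /b; case: (val v) (val w) => [s|s] [t|t].
have be : subrel b (@glued p i a).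
  move=> v w; rewrite /b gluedE.
  by case: (val v) (val w) => [s|s] [t|t] //; apply: badP.
have ainV s t : bad (s, t) -> inl s \in vertices i a.
  move/badP; rewrite /pairs mem_cat.
  by case/orP=> [/down_pairsP|/up_pairsP] [u [-> _]]; apply: vertex_a_proof.
have iinV s t : bad (s, t) -> inr t \in vertices i a.
  move/badP; rewrite /pairs mem_cat.
  by case/orP=> [/down_pairsP|/up_pairsP] [u [_ ->]]; apply: vertex_i_proof.
suff H : forall v w, ~~ b v w.
  exact: (negP (H (SeqSub (ainV _ _ bxy)) (SeqSub (iinV _ _ bxy))) bxy).
apply: (leafless_subgraph_of_tree (@glued_sym _ i a) (@glued_connect _ i a)) => //.
  by apply: leq_ltn_trans (card_glued_le i a) _; rewrite ltn_double card_vertices.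
move=> [[s|s] sV] [[t|t] tV]; rewrite /b //= => bst.
  have [t' t't bst'] := bada _ _ bst.
  by exists (SeqSub (iinV _ _ bst')) => //; apply: contra t't => /eqP[->].
have [t' t't bst'] := badi _ _ bst.
by exists (SeqSub (ainV _ _ bst')) => //; apply: contra t't => /eqP[->].
Qed.

Lemma map_down_pairs (T : Type) (f : nat * nat -> T) i a :
  map f (down_pairs i a) = [seq f (tnth a u, tnth i u) | u <- enum 'I_p].
Proof. exact: esym (map_comp _ _ _). Qed.

Lemma map_up_pairs (T : Type) (f : nat * nat -> T) i a :
  map f (up_pairs i a) = [seq f (tnth a (@ordS p u), tnth i u) | u <- enum 'I_p].
Proof. exact: esym (map_comp _ _ _). Qed.

Lemma perm_map_ordS : perm_eq (enum 'I_p) (map (@ordS p) (enum 'I_p)).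
Proof.
apply: uniq_perm; rewrite ?enum_uniq //.
  by rewrite map_inj_uniq ?enum_uniq //; apply: ordS_inj.
move=> u; rewrite mem_enum; apply/esym/mapP.
by exists (@ord_pred p u); rewrite ?mem_enum // ord_predK.
Qed.

Lemma perm_fst_pairs i a :
  perm_eq [seq e.1 | e <- down_pairs i a] [seq e.1 | e <- up_pairs i a].
Proof.
rewrite map_down_pairs map_up_pairs /=.
have -> : [seq tnth a (@ordS p u) | u <- enum 'I_p] =
    map (tnth a) (map (@ordS p) (enum 'I_p)) by rewrite -[RHS]map_comp.
by rewrite perm_map // perm_map_ordS.
Qed.

Lemma snd_pairs i a : [seq e.2 | e <- down_pairs i a] = [seq e.2 | e <- up_pairs i a].
Proof. by rewrite map_down_pairs map_up_pairs. Qed.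

(** Every vertex has as many down as up edges, so the glued edges carrying
    unequal numbers of down and up edges form a leafless set. *)
Lemma tree_balanced i a : (size (undup (pairs i a)) < nb_values a + nb_values i)%N ->
  perm_eq (down_pairs i a) (up_pairs i a).
Proof.
move=> tree; set D := down_pairs i a; set U := up_pairs i a.
pose bad e := count_mem e D != count_mem e U.
have split_count (Q : pred (nat * nat)) x y s : Q (x, y) ->
    (count Q s = count_mem (x, y) s + count (predI Q (predC1 (x, y))) s)%N.
  move=> Qxy; rewrite -count_predUI [X in (_ + X)%N](_ : _ = 0%N) ?addn0; last first.
    rewrite -(count_pred0 s); apply: eq_count => e /=.
    by case: eqP; rewrite ?andbF.
  by apply: eq_count => e /=; case: eqP => [->|]; rewrite ?andbT //= Qxy.
(* An edge cannot be the only unbalanced one in a set that is balanced overall. *)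
have other (Q : pred (nat * nat)) x y : count Q D = count Q U -> Q (x, y) -> bad (x, y) ->
    exists e, [/\ Q e, e != (x, y) & bad e].
  move=> QDU Qxy bxy; have [//|nE] := pselect (exists e, [/\ Q e, e != (x, y) & bad e]).
  have E : count (predI Q (predC1 (x, y))) D = count (predI Q (predC1 (x, y))) U.
    apply: eq_count_in => e /= /andP[Qe exy]; apply/eqP; apply: contra_notT nE => be.
    by exists e.
  move: QDU; rewrite !(split_count Q x y) // E => /eqP.
  by rewrite eqn_add2r; move: bxy; rewrite /bad => /negPf->.
have nbad : forall e, ~~ bad e.
  apply: (leafless_pairs tree).
  - move=> e; rewrite [e \in bad]unfold_in /bad => be; rewrite mem_cat; apply: contraNT be.
    by rewrite negb_or => /andP[/count_memPn-> /count_memPn->].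
  - move=> x y bxy; have [|//||[x' y'] [/= /eqP-> ne be]] := @other (fun e => e.1 == x) x y.
    + have /permP/(_ (pred1 x)) := perm_fst_pairs i a; rewrite !count_map.
      by [].
    + exact: bxy.
    by exists y' => //; move: ne; rewrite xpair_eqE eqxx.
  - move=> x y bxy; have [|//||[x' y'] [/= /eqP-> ne be]] := @other (fun e => e.2 == y) x y.
    + by have := congr1 (count_mem y) (snd_pairs i a); rewrite !count_map.
    + exact: bxy.
    by exists x' => //; move: ne; rewrite xpair_eqE eqxx andbT.
by apply/allP => e _ /=; have := nbad e; rewrite negbK.
Qed.

(** The property of being a Delta_1-graph in terms of edge multiplicities alone:
    this form involves no vertex type and is visibly invariant under
    relabeling of the vertices. *)
Definition paired_tree i a := [&& uniq (down_pairs i a),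
  perm_eq (down_pairs i a) (up_pairs i a) & nb_values a + nb_values i == p.+1].

(** The [2p] edges fall into glued edges of multiplicity at least 2, whence at
    most [p] glued edges; in the case of equality all the multiplicities are
    2, and [tree_balanced] splits them as one down and one up edge. *)
Lemma nb_values_le_of_no_single_edge i a : (forall e, count_mem e (pairs i a) != 1%N) ->
  (nb_values a + nb_values i <= p.+1)%N /\
  (nb_values a + nb_values i = p.+1 -> paired_tree i a).
Proof.
move=> c1; set L := pairs i a in c1 *.
have c2 e : e \in undup L -> (2 <= count_mem e L)%N.
  rewrite mem_undup -has_pred1 has_count; have := c1 e; lia.
have le1 := nb_values_le_pairs i a p_gt0; rewrite -/L in le1.
have sL := size_pairs i a; rewrite -/L size_sum_count in sL.
have le2 : ((size (undup L)).*2 <= p.*2)%N.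
  by rewrite -sL -muln2; apply: leq_muln_size_sum.
rewrite leq_double in le2.
split; first exact: leq_trans le1 _.
move=> nbE; rewrite /paired_tree nbE eqxx andbT.
have perm : perm_eq (down_pairs i a) (up_pairs i a) by apply: tree_balanced; rewrite nbE ltnS.
rewrite perm andbT.
have sU : size (undup L) = p by apply/eqP; rewrite eqn_leq le2 -ltnS -nbE.
have c2E : {in undup L, forall e, count_mem e L = 2}.
  by apply: eq_sum_muln_size c2 _; rewrite sL sU muln2.
apply: count_mem_uniq => e.
have [eD|/count_memPn->//] := boolP (e \in down_pairs i a).
have : e \in undup L by rewrite mem_undup mem_cat eD.
move=> /c2E; rewrite count_cat.
have /permP/(_ (pred1 e)) <- := perm.
lia.
Qed.

Lemma paired_tree_size_undup i a : paired_tree i a -> (size (undup (pairs i a)) <= p)%N.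
Proof.
case/and3P=> _ /perm_mem DU _; rewrite -[leqRHS](size_down_pairs i a).
apply: uniq_leq_size (undup_uniq _) _ => e; rewrite mem_undup mem_cat DU.
by rewrite orbb.
Qed.

Lemma card_coincide i a u :
  #|[set v : 'I_p | coincide (down_edge i a u) (up_edge i a v)]%SET|
  = count_mem (tnth a u, tnth i u) (up_pairs i a).
Proof.
rewrite cardE /up_pairs count_map -size_filter; congr size.
rewrite enumT; apply: eq_filter => v /=; rewrite inE /coincide /down_edge /up_edge /=.
rewrite !xpair_eqE /= eq_sym [tnth i v == _]eq_sym.
by [].
Qed.

Lemma down_pairs_inj i a :
  uniq (down_pairs i a) -> injective (fun u => (tnth a u, tnth i u)).
Proof. by move=> H; apply/injectiveP. Qed.

Lemma Delta1_paired_tree i a : Delta1_graph i a (nb_values a) <-> paired_tree i a.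
Proof.
split=> [[_ c1 _ _]|G].
  rewrite card_vertices => nbE.
  have c1' e : e \in down_pairs i a -> count_mem e (up_pairs i a) = 1%N.
    by case/down_pairsP=> u ->; rewrite -card_coincide c1.
  have perm : perm_eq (down_pairs i a) (up_pairs i a).
    apply: tree_balanced; rewrite nbE ltnS -[leqRHS](size_up_pairs i a).
    apply: uniq_leq_size (undup_uniq _) _ => e; rewrite mem_undup mem_cat.
    by case/orP=> // /c1' c; rewrite -has_pred1 has_count c.
  rewrite /paired_tree nbE eqxx perm !andbT; apply: count_mem_uniq => e.
  have [eD|/count_memPn->//] := boolP (e \in down_pairs i a).
  by have /permP/(_ (pred1 e)) -> := perm; rewrite c1'.
have le := paired_tree_size_undup G; case/and3P: G => Du perm /eqP nbE.
have tree : (#|[set q : seq_sub (vertices i a) * seq_sub (vertices i a) |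
      glued q.1 q.2]| < #|{: seq_sub (vertices i a)}|.*2)%N.
  apply: leq_ltn_trans (card_glued_le i a) _.
  by rewrite ltn_double card_vertices nbE ltnS.
split=> //.
- move=> u; rewrite card_coincide; have /permP/(_ (pred1 (tnth a u, tnth i u))) <- := perm.
  by rewrite count_uniq_mem // (_ : _ \in _) //; apply/down_pairsP; exists u.
- split.
  + by rewrite card_vertices nbE.
  + by move=> x; rewrite gluedE; case: (val x).
  + exact: glued_sym.
  + exact: glued_connect.
  + move=> c c2; apply: tree_acyclic => //; [exact: glued_sym|exact: glued_connect].
- have -> : edge_set (@glued p i a) =
     [set [set vertex_a i a u; vertex_i i a u]%SET | u : 'I_p]%SET.
    apply/setP => A; rewrite inE; apply/existsP/imsetP => [[x /existsP[y /andP[exy /eqP->]]]|[u _ ->]].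
      move: exy; rewrite gluedE.
      have pD e : e \in pairs i a -> exists u, e = (tnth a u, tnth i u).
        rewrite mem_cat -(perm_mem perm) orbb.
        exact: down_pairsP.
      case Ex: (\val x) => [s|s]; case Ey: (\val y) => [t|t] // /pD[u [sE tE]];
        exists u => //; [|rewrite finset.setUC]; congr [set _; _]%SET; apply: val_inj;
        by rewrite ?Ex ?Ey ?sE ?tE.
    by exists (vertex_a i a u); apply/existsP; exists (vertex_i i a u); rewrite glued_down eqxx.
  rewrite card_imset ?card_ord // => u v /setP E.
  have ai s t : vertex_a i a s == vertex_i i a t = false by apply/eqP => -[].
  have ia s t : vertex_i i a s == vertex_a i a t = false by apply/eqP => -[].
  have /eqP e1 : vertex_a i a u == vertex_a i a v.
    by have := E (vertex_a i a u); rewrite !inE !ai !orbF eqxx => <-.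
  have [Ea] := congr1 val e1.
  have /eqP e2 : vertex_i i a u == vertex_i i a v.
    by have := E (vertex_i i a u); rewrite !inE !ia !orFb eqxx => <-.
  have [Ei] := congr1 val e2.
  by apply: (down_pairs_inj Du); rewrite /= Ea Ei.
- by rewrite card_vertices nbE.
Qed.

End Trees.

(** * Weights of closed walks *)

Lemma map_uniq_inj_in (X Y : eqType) (g : X -> Y) (s : seq X) :
  uniq (map g s) -> {in s &, injective g}.
Proof.
elim: s => [|x s IH] //= /andP[gx gs] y z; rewrite !inE.
case/orP=> [/eqP->|ys] /orP[/eqP->|zs] // gyz.
- by rewrite gyz map_f in gx.
- by rewrite -gyz map_f in gx.
- exact: IH gyz.
Qed.

Lemma size_undup_map_inj_in (X Y : eqType) (g : X -> Y) (s : seq X) :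
  (size (undup s) <= size (undup (map g s)))%N -> {in s &, injective g}.
Proof.
move=> le x y xs ys; apply: (map_uniq_inj_in (s := undup s)); rewrite ?mem_undup //.
apply: (leq_size_uniq (undup_uniq (map g s))); last by rewrite size_map.
move=> z; rewrite mem_undup => /mapP[t ts ->]; apply/mapP.
by exists t => //; rewrite mem_undup.
Qed.

(** Functions constant on the classes of a surjection [b] are the functions of
    [b].  Used both for the coordinates that respect a tree pairing and for the
    index choices with a prescribed canonical form. *)
Lemma sum_ffun_comp (p : nat) (X Y : finType) (V : nmodType) (b : 'I_p -> X)
    (F : {ffun 'I_p -> Y} -> V) : (forall x, exists u, b u = x) ->
  (\sum_(g : {ffun 'I_p -> Y} | [forall u, forall v, (b u == b v) ==> (g u == g v)]) F g
   = \sum_(f : {ffun X -> Y}) F [ffun u => f (b u)])%R.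
Proof.
move=> /fin_all_exists[c bc].
rewrite (reindex_onto (fun f : {ffun X -> Y} => [ffun u => f (b u)])
    (fun g => [ffun x => g (c x)])) /=; last first.
  move=> g /forallP Pg; apply/ffunP => u; rewrite !ffunE.
  by have /forallP/(_ u) := Pg (c (b u)); rewrite bc eqxx => /eqP.
apply: eq_bigl => f; apply/andP; split.
  by apply/forallP => u; apply/forallP => v; apply/implyP => /eqP buv; rewrite !ffunE buv.
by apply/eqP/ffunP => x; rewrite !ffunE bc.
Qed.

Section Weights.
Variables (p m n : nat).
Hypothesis p_gt0 : (0 < p)%N.
Variables (K : numDomainType) (mu : nat -> nat -> K).
Hypothesis mu00 : mu 0 0 = 1%R.
Hypothesis mu10 : mu 1 0 = 0%R.
Hypothesis mu01 : mu 0 1 = 0%R.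
Hypothesis muSS : forall x y, mu x.+1 y.+1 = mu x y.
Implicit Types (al : {ffun 'I_p -> 'I_m}) (io : {ffun 'I_p -> 'I_n}).

Definition nat_tuple (q : nat) (f : {ffun 'I_p -> 'I_q}) : p.-tuple nat :=
  [tuple val (f u) | u < p].

Definition down_count al io x y :=
  (\sum_(u < p) ((al u == x) && (io u == y)))%N.
Definition up_count al io x y :=
  (\sum_(u < p) ((al (ordS u) == x) && (io u == y)))%N.

(** The expectation of the product of the entries along the closed walk, [mu x y]
    standing for the mixed moment of order [x] in the conjugate of an entry and
    [y] in the entry itself. *)
Definition weight al io : K :=
  (\prod_(x < m) \prod_(y < n) mu (down_count al io x y) (up_count al io x y))%R.

Lemma count_down_pairs (i a : p.-tuple nat) (P : pred (nat * nat)) :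
  count P (down_pairs i a) = (\sum_(u < p) P (tnth a u, tnth i u))%N.
Proof. by rewrite count_map -sum1_count big_mkcond big_enum /=; apply: eq_bigr => u _; case: (P _). Qed.

Lemma count_up_pairs (i a : p.-tuple nat) (P : pred (nat * nat)) :
  count P (up_pairs i a) = (\sum_(u < p) P (tnth a (ordS u), tnth i u))%N.
Proof. by rewrite count_map -sum1_count big_mkcond big_enum /=; apply: eq_bigr => u _; case: (P _). Qed.

Lemma count_mem_down al io (x : 'I_m) (y : 'I_n) :
  count_mem (val x, val y) (down_pairs (nat_tuple io) (nat_tuple al))
  = down_count al io x y.
Proof. by rewrite count_down_pairs; apply: eq_bigr => u _ /=; rewrite !tnth_mktuple. Qed.

Lemma count_mem_up al io (x : 'I_m) (y : 'I_n) :
  count_mem (val x, val y) (up_pairs (nat_tuple io) (nat_tuple al))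
  = up_count al io x y.
Proof. by rewrite count_up_pairs; apply: eq_bigr => u _ /=; rewrite !tnth_mktuple. Qed.

Lemma mu_diag x : mu x x = 1%R.
Proof. by elim: x => // x IH; rewrite muSS. Qed.

Lemma mu_succ x : mu x.+1 x = 0%R.
Proof. by elim: x => // x IH; rewrite muSS. Qed.

Lemma weight_neq0 al io x y : weight al io != 0%R ->
  mu (down_count al io x y) (up_count al io x y) != 0%R.
Proof. by move=> /prodf_neq0/(_ x isT)/prodf_neq0/(_ y isT). Qed.

Lemma weight_neq0_count al io : weight al io != 0%R ->
  forall e, count_mem e (pairs (nat_tuple io) (nat_tuple al)) != 1%N.
Proof.
move=> w0 [s t]; set L := pairs _ _.
have : (s, t) \in L -> exists (x : 'I_m) (y : 'I_n), s = val x /\ t = val y.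
  rewrite mem_cat => /orP[/down_pairsP|/up_pairsP] [u [-> ->]]; rewrite !tnth_mktuple.
    by exists (al u), (io u).
  by exists (al (ordS u)), (io u).
move=> H; have [/H[x [y [-> ->]]]|/count_memPn->//] := boolP ((s, t) \in L).
have := weight_neq0 x y w0; rewrite count_cat count_mem_down count_mem_up.
case: (down_count _ _ _ _) (up_count _ _ _ _) => [|[|d]] [|[|u]] //=.
- by rewrite mu01 eqxx.
- by rewrite mu10 eqxx.
Qed.

Section TreePairing.
Variables (al : {ffun 'I_p -> 'I_m}) (i0 : p.-tuple nat).
Hypothesis i0_paired : paired_tree i0 (nat_tuple al).

(** [f u] is the position of the up edge that coincides with the down edge at
    position [u]. *)
Lemma exists_up_match : exists f : 'I_p -> 'I_p, [/\ injective f,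
  forall u, al (ordS (f u)) = al u & forall u, tnth i0 (f u) = tnth i0 u].
Proof.
have /and3P[Du perm _] := i0_paired.
have ex u : exists v, al (ordS v) = al u /\ tnth i0 v = tnth i0 u.
  have : (tnth (nat_tuple al) u, tnth i0 u) \in down_pairs i0 (nat_tuple al).
    by apply/down_pairsP; exists u.
  rewrite (perm_mem perm) => /up_pairsP[v [E1 E2]]; exists v; split => //.
  by apply: val_inj; move: E1; rewrite !tnth_mktuple.
have [f fP] := fin_all_exists ex; exists f; split => [u v fuv|u|u]; try by case: (fP u).
apply: (down_pairs_inj Du); rewrite !tnth_mktuple.
have [<- <-] := fP u; have [<- <-] := fP v.
by rewrite fuv.
Qed.

(** Call a glued edge bad if [io] differs at its down and up positions.  An
    alpha-vertex on a single bad edge would carry a factor [mu d.+1 d], which is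
    zero; an i-vertex cannot lie on a single bad edge, since the matching
    permutes the positions on that vertex.  So there are no bad edges in the
    tree.  Then the pairs (i0, io) also label the i-vertices of a connected
    graph with [p] glued edges; they cannot take more values than [i0] does,
    which makes [io] a function of [i0]. *)
Lemma weight_neq0_respects io u v : weight al io != 0%R ->
  tnth i0 u = tnth i0 v -> io u = io v.
Proof.
move=> w0; have [f [f_inj fa fi]] := exists_up_match.
have /and3P[Du perm /eqP nbE] := i0_paired.
have upE x y : up_count al io x y = (\sum_(w < p) ((al w == x) && (io (f w) == y)))%N.
  by rewrite /up_count (reindex_inj f_inj); apply: eq_bigr => w _; rewrite fa.
(* The bad edges, each recorded at the position of its down edge. *)
pose bad (e : nat * nat) := [exists w, (e == (val (al w), tnth i0 w)) && (io w != io (f w))].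
have nbad : forall e, ~~ bad e.
  apply: (@leafless_pairs _ i0 (nat_tuple al)).
  - by rewrite nbE ltnS paired_tree_size_undup.
  - move=> e /existsP[w /andP[/eqP-> _]]; rewrite mem_cat; apply/orP; left.
    by apply/down_pairsP; exists w; rewrite tnth_mktuple.
  - move=> x y /existsP[w /andP[/eqP[-> ->] bw]].
    have [[w' [w'w aw bw']]|nE] :=
        pselect (exists w', [/\ w' != w, al w' = al w & io w' != io (f w')]).
      exists (tnth i0 w').
        apply: contra w'w => /eqP i0E; apply/eqP/(down_pairs_inj Du).
        by rewrite !tnth_mktuple aw i0E.
      by apply/existsP; exists w'; rewrite aw eqxx.
    have := weight_neq0 (al w) (io w) w0; rewrite upE /down_count.
    rewrite (bigD1 w) //= [X in mu _ X](bigD1 w) //= !eqxx [io (f w) == _]eq_sym (negPf bw).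
    rewrite add0n add1n (eq_bigr (fun w' => ((al w' == al w) && (io (f w') == io w) : nat))).
      by rewrite mu_succ eqxx.
    move=> w' w'w; case: eqP => //= aw; congr (nat_of_bool (_ == _)).
    by apply/eqP; apply: contra_notT nE => bw'; exists w'.
  - move=> x y /existsP[w /andP[/eqP[-> ->] bw]].
    have [[w' [w'w iw bw']]|nE] :=
        pselect (exists w', [/\ w' != w, tnth i0 w' = tnth i0 w & io w' != io (f w')]).
      exists (val (al w')).
        apply: contra w'w => /eqP aE; apply/eqP/(down_pairs_inj Du).
        by rewrite !tnth_mktuple aE iw.
      by apply/existsP; exists w'; rewrite iw eqxx.
    (* Count the positions on this i-vertex where [io] takes the value [io w],
       directly and through the matching. *)
    exfalso; pose N g := (\sum_(w' < p) ((tnth i0 w' == tnth i0 w) && (io (g w') == io w)))%N.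
    have : N id = N f.
      by rewrite /N (reindex_inj f_inj); apply: eq_bigr => w' _; rewrite fi.
    rewrite /N (bigD1 w) //= [RHS](bigD1 w) //= !eqxx [io (f w) == _]eq_sym (negPf bw).
    rewrite add0n add1n [RHS](eq_bigr (fun w' => ((tnth i0 w' == tnth i0 w) && (io w' == io w) : nat))).
      by move/eqP; rewrite eqn_leq ltnn.
    move=> w' w'w; case: eqP => //= iw; congr (nat_of_bool (_ == _)).
    by apply/esym/eqP; apply: contra_notT nE => bw'; exists w'.
have iof w : io (f w) = io w.
  apply/esym/eqP; apply: contraT => bw.
  have := nbad (val (al w), tnth i0 w); apply: contraR => _.
  by apply/existsP; exists w; rewrite eqxx.
(* [enc] turns the pairs (i0, io) into labels; [g] recovers [i0]. *)
pose enc (q : nat * nat) : nat := pickle q.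
pose g c := if @unpickle (nat * nat)%type c is Some q then q.1 else 0%N.
have gK q : g (enc q) = q.1 by rewrite /g /enc pickleK.
have enc_inj : injective enc by apply: pcan_inj pickleK.
pose i1 : p.-tuple nat := [tuple enc (tnth i0 w, val (io w)) | w < p].
have c1 e : count_mem e (pairs i1 (nat_tuple al)) != 1%N.
  rewrite count_cat (_ : count_mem e (up_pairs _ _) = count_mem e (down_pairs i1 (nat_tuple al))).
    by rewrite addnn; case: (count_mem _ _).
  rewrite count_up_pairs count_down_pairs (reindex_inj f_inj); apply: eq_bigr => w _.
  by rewrite !tnth_mktuple fa fi iof.
have [le _] := nb_values_le_of_no_single_edge p_gt0 c1.
have i0E : tval i0 = map g i1.
  apply: (@eq_from_nth _ 0%N); first by rewrite size_map !size_tuple.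
  move=> j; rewrite size_tuple => jp; rewrite (nth_map 0%N) ?size_tuple //.
  by rewrite -!(tnth_nth _ _ (Ordinal jp)) tnth_mktuple gK.
move: le; rewrite -nbE leq_add2l /nb_values i0E => /size_undup_map_inj_in inj i0uv.
have : tnth i1 u = tnth i1 v.
  apply: inj; rewrite ?mem_tnth //.
  by rewrite !tnth_mktuple !gK.
by rewrite !tnth_mktuple => /enc_inj[_ E]; apply: val_inj.
Qed.

Lemma weight_respects io : (forall u v, tnth i0 u = tnth i0 v -> io u = io v) ->
  weight al io = 1%R.
Proof.
move=> ri; have [f [f_inj fa fi]] := exists_up_match.
rewrite /weight big1 // => x _; rewrite big1 // => y _.
rewrite [up_count _ _ _ _](_ : _ = down_count al io x y) ?mu_diag //.
rewrite /up_count (reindex_inj f_inj); apply: eq_bigr => w _; rewrite fa.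
by rewrite (ri (f w) w).
Qed.

(** The coordinates that respect [i0] are free on each of its values. *)
Lemma sum_weight_paired_tree :
  (\sum_io weight al io = n%:R ^+ nb_values i0)%R.
Proof.
have tin (u : 'I_p) : (index (tnth i0 u) (undup i0) < nb_values i0)%N.
  by rewrite index_mem mem_undup mem_tnth.
pose b u := Ordinal (tin u).
have b_surj x : exists u, b u = x.
  have xs : nth 0%N (undup i0) x \in i0 by rewrite -mem_undup mem_nth.
  have /tnthP[u uE] := xs; exists u; apply: val_inj => /=.
  by rewrite -uE index_uniq ?undup_uniq.
have bE u v : (b u == b v) = (tnth i0 u == tnth i0 v).
  apply/eqP/eqP => [[E]|E]; last by apply: val_inj; rewrite /= E.
  rewrite -(nth_index 0%N (s := undup i0) (x := tnth i0 u)) ?mem_undup ?mem_tnth //.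
  by rewrite E nth_index ?mem_undup ?mem_tnth.
rewrite (bigID (fun g : {ffun 'I_p -> 'I_n} =>
    [forall u, forall v, (b u == b v) ==> (g u == g v)])) /=.
rewrite [X in (_ + X)%R]big1 ?addr0; last first.
  move=> io nr; apply/eqP; apply: contraNT nr => w0; apply/forallP => u.
  apply/forallP => v; apply/implyP; rewrite bE => /eqP i0uv.
  by apply/eqP/(weight_neq0_respects w0).
rewrite (eq_bigr (fun _ => 1%R)); last first.
  move=> io /forallP ri; apply: weight_respects => u v i0uv; apply/eqP.
  by have /forallP/(_ v)/implyP := ri u; apply; rewrite bE i0uv.
rewrite (sum_ffun_comp (fun _ => 1%R)) // sumr_const card_ffun !card_ord.
by rewrite natrX.
Qed.

End TreePairing.

End Weights.

Section WeightBound.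
Variables (p m n : nat).
Hypothesis p_gt0 : (0 < p)%N.
Variables (K : numDomainType) (mu : nat -> nat -> K).
Hypothesis mu00 : mu 0 0 = 1%R.
Hypothesis mu10 : mu 1 0 = 0%R.
Hypothesis mu01 : mu 0 1 = 0%R.
Hypothesis muSS : forall x y, mu x.+1 y.+1 = mu x y.
Hypothesis mu_le1 : forall x y, (`|mu x y| <= 1)%R.

(** A function with at most [r] values factors through ['I_r]. *)
Lemma card_few_values r :
  (#|[set io : {ffun 'I_p -> 'I_n} | (nb_values (nat_tuple io) <= r)%N]%SET| <= r ^ p * n ^ r)%N.
Proof.
pose h (q : {ffun 'I_p -> 'I_r} * {ffun 'I_r -> 'I_n}) : {ffun 'I_p -> 'I_n} :=
  [ffun u => q.2 (q.1 u)].
have -> : (r ^ p * n ^ r)%N = #|[set: {ffun 'I_p -> 'I_r} * {ffun 'I_r -> 'I_n}]%SET|.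
  by rewrite cardsT card_prod !card_ffun !card_ord.
apply: leq_trans (leq_imset_card h _); apply/subset_leq_card/fintype.subsetP => io.
rewrite inE => le; apply/imsetP; set s := undup (nat_tuple io).
have lt u : (index (val (io u)) s < r)%N.
  apply: leq_trans le; rewrite index_mem mem_undup; apply/tnthP; exists u.
  by rewrite tnth_mktuple.
have [c cP] : exists c : 'I_r -> 'I_p,
    forall u, io (c (Ordinal (lt u))) = io u.
  exists (fun x : 'I_r => odflt (Ordinal p_gt0) [pick u | index (val (io u)) s == val x]) => u.
  case: pickP => [v|/(_ u)]; last by rewrite eqxx.
  move=> /eqP /= E; apply: val_inj; rewrite -[LHS](nth_index 0%N (s := s)) ?E ?nth_index //.
    by rewrite mem_undup; apply/tnthP; exists u; rewrite tnth_mktuple.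
  by rewrite mem_undup; apply/tnthP; exists v; rewrite tnth_mktuple.
exists ([ffun u => Ordinal (lt u)], [ffun x => io (c x)]); first by rewrite inE.
by apply/ffunP => u; rewrite !ffunE cP.
Qed.

Lemma norm_weight_le1 (al : {ffun 'I_p -> 'I_m}) (io : {ffun 'I_p -> 'I_n}) :
  (`|weight mu al io| <= 1)%R.
Proof.
have prod_le1 q (F : 'I_q -> K) : (forall x, `|F x| <= 1)%R -> (`|\prod_x F x| <= 1)%R.
  by move=> F1; rewrite normr_prod; apply: Num.Theory.prodr_ile1 => x _; rewrite normr_ge0 F1.
apply: (prod_le1) => x; apply: (prod_le1) => y; exact: mu_le1.
Qed.

Lemma norm_sum_weight_le (al : {ffun 'I_p -> 'I_m}) :
    ~ (exists i : p.-tuple nat, paired_tree i (nat_tuple al)) ->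
  (`|\sum_(io : {ffun 'I_p -> 'I_n}) weight mu al io|
    <= (p ^ p * n ^ (p - nb_values (nat_tuple al)))%:R)%R.
Proof.
move=> ngood; set s := nb_values _.
apply: (@le_trans _ _ (\sum_(io : {ffun 'I_p -> 'I_n}) (nb_values (nat_tuple io) <= p - s)%N%:R)%R).
  apply: le_trans (ler_norm_sum _ _ _) _; apply: ler_sum => io _.
  have [->|w0] := eqVneq (weight mu al io) 0%R; first by rewrite normr0 ler0n.
  have [] := nb_values_le_of_no_single_edge p_gt0 (weight_neq0_count mu10 mu01 w0).
  rewrite leq_eqVlt => /orP[/eqP E G|].
    by case: ngood; exists (nat_tuple io); apply: G.
  rewrite ltnS -/s => le _; rewrite leq_subRL; last first.
    by apply: leq_trans le; apply: leq_addr.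
  by rewrite le norm_weight_le1.
rewrite -natr_sum ler_nat; set r := (p - s)%N.
rewrite (eq_bigr (fun io : {ffun 'I_p -> 'I_n} =>
  if (nb_values (nat_tuple io) <= r)%N then 1%N else 0%N)); last by move=> io _; case: leqP.
rewrite -big_mkcond sum1dep_card; apply: leq_trans (card_few_values r) _.
by rewrite leq_mul2r leq_exp2r // leq_subr orbT.
Qed.

End WeightBound.

(** * Canonical forms of sequences *)

Section CanonicalSequences.
Variable p : nat.
Implicit Types a b i : p.-tuple nat.

(** Equality up to renaming of the values. *)
Definition same_kernel a b :=
  forall u v, (tnth a u == tnth a v) = (tnth b u == tnth b v).

Lemma same_kernel_map a b : same_kernel a b ->
  exists g, forall u, tnth b u = g (tnth a u).
Proof.
move=> ab; exists (fun x => if [pick u | tnth a u == x] is Some u then tnth b u else 0%N).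
move=> u; case: pickP => [v|/(_ u)]; last by rewrite eqxx.
by rewrite ab => /eqP.
Qed.

Lemma nb_values_same_kernel a b : same_kernel a b -> nb_values a = nb_values b.
Proof.
have le c d : same_kernel c d -> (nb_values d <= nb_values c)%N.
  move=> /same_kernel_map[g gE]; rewrite /nb_values -(size_map g (undup c)).
  apply: uniq_leq_size (undup_uniq _) _ => x; rewrite mem_undup => /tnthP[u ->].
  by rewrite gE map_f // mem_undup mem_tnth.
by move=> ab; apply/eqP; rewrite eqn_leq !le // => u v; rewrite ab.
Qed.

Lemma paired_tree_same_kernel i i' a b :
  same_kernel i i' -> same_kernel a b -> paired_tree i a -> paired_tree i' b.
Proof.
move=> ii ab /and3P[Du perm nbE]; have [g gE] := same_kernel_map ab.
have [g' g'E] := same_kernel_map ii; pose G (e : nat * nat) := (g e.1, g' e.2).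
apply/and3P; split.
- apply/injectiveP => u v [E1 E2]; apply: (down_pairs_inj Du); congr (_, _); apply/eqP.
    by rewrite ab E1.
  by rewrite ii E2.
- have -> : down_pairs i' b = map G (down_pairs i a).
    by rewrite map_down_pairs; apply: eq_map => u; rewrite /G /= gE g'E.
  have -> : up_pairs i' b = map G (up_pairs i a).
    by rewrite map_up_pairs; apply: eq_map => u; rewrite /G /= gE g'E.
  exact: perm_map.
- by rewrite -(nb_values_same_kernel ab) -(nb_values_same_kernel ii).
Qed.

(** By induction along the sequence: a value at [u] exceeds the previous ones by
    at most one, so the values up to [u] leave no gap. *)
Lemma canonical_prefix b (u : 'I_p) t : canonical_seq b -> (0 < t <= tnth b u)%N ->
  exists2 v : 'I_p, (v <= u)%N & tnth b v = t.
Proof.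
case=> b0 b1 bmax; have [N] := ubnP (u : nat); elim: N u => // N IH u uN tu.
have [->|tNu] := eqVneq t (tnth b u); first by exists u.
have [u0|u0] := posnP u; first by have := b1 u u0; move: tu tNu; lia.
have [|w wu wE] := @eq_bigmax_cond _ [pred v : 'I_p | (v < u)%N] (fun v => tnth b v).
  by apply/card_gt0P; exists (Ordinal (leq_ltn_trans (leq0n u) (ltn_ord u))).
have [|v vw vt] := IH w (leq_trans wu uN).
  by have := bmax u u0; rewrite [X in (_ <= X.+1)%N](_ : _ = tnth b w) //; move: tu tNu; lia.
by exists v => //; apply: leq_trans vw (ltnW wu).
Qed.

(** A value that has not occurred before can only be the next one, because by
    [canonical_prefix] all the smaller positive ones have occurred. *)
Lemma canonical_new b (u : 'I_p) : canonical_seq b -> (forall v : 'I_p, (v < u)%N -> tnth b v != tnth b u) ->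
  tnth b u = (\max_(v < p | (v < u)%N) tnth b v).+1.
Proof.
move=> cb new; have [b0 b1 bmax] := cb.
have [u0|u0] := posnP u.
  rewrite b1 // big_pred0 // => v; by rewrite u0.
apply/eqP; rewrite eqn_leq bmax //= ltnNge; apply/negP => le.
have [|w wu wE] := @eq_bigmax_cond _ [pred v : 'I_p | (v < u)%N] (fun v => tnth b v).
  by apply/card_gt0P; exists (Ordinal (leq_ltn_trans (leq0n u) (ltn_ord u))).
have [|v vw vu] := @canonical_prefix b w (tnth b u) cb.
  by rewrite b0 -wE.
by have := new v (leq_ltn_trans vw wu); rewrite vu eqxx.
Qed.

Lemma canonical_unique b b' : canonical_seq b -> canonical_seq b' ->
  same_kernel b b' -> b = b'.
Proof.
move=> cb cb' bb; apply: eq_from_tnth => u; have [N] := ubnP (u : nat).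
elim: N u => // N IH u uN.
have [[v vu /eqP vE]|new] := pselect (exists2 v : 'I_p, (v < u)%N & tnth b v = tnth b u).
  rewrite -(eqP vE) IH ?(leq_trans vu) //; apply/eqP; by rewrite -bb.
have nb : forall v : 'I_p, (v < u)%N -> tnth b v != tnth b u.
  by move=> v vu; apply: contra_notN new => /eqP; exists v.
have nb' : forall v : 'I_p, (v < u)%N -> tnth b' v != tnth b' u.
  by move=> v vu; rewrite -bb; apply: nb.
rewrite (canonical_new cb nb) (canonical_new cb' nb').
by congr _.+1; apply: eq_bigr => v vu; apply: IH; apply: leq_trans vu _.
Qed.

Lemma mem_canonical b t : canonical_seq b -> (t \in tval b) = (0 < t <= nb_values b)%N.
Proof.
move=> cb; have [b0 b1 bmax] := cb.
pose M := (\max_(u < p) tnth b u)%N.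
have memE : tval b =i iota 1 M.
  move=> x; rewrite mem_iota add1n ltnS; apply/idP/idP => [/tnthP[u ->]|/andP[x0 xM]].
    by rewrite b0 /= (leq_bigmax u).
  have p0 : (0 < #|{: 'I_p}|)%N.
    rewrite lt0n; apply: contraTneq xM => /card0_eq E0.
    by rewrite /M big_pred0 // -ltnNge.
  have [u uE] := bigop.eq_bigmax (fun u => tnth b u) p0.
  have [|v _ <-] := @canonical_prefix b u x cb; last exact: mem_tnth.
  by rewrite x0 -uE.
have -> : nb_values b = M.
  rewrite -[RHS](size_iota 1); apply/perm_size/uniq_perm; rewrite ?undup_uniq ?iota_uniq //.
  by move=> x; rewrite mem_undup.
by rewrite memE mem_iota add1n ltnS.
Qed.

(** [rank a N] counts the values that make their first appearance before
    position [N]; numbering each value by its order of first appearance yields the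
    canonical form [relabeling a]. *)
Definition new_at a j := index (nth 0%N a j) a == j.
Definition rank a N := count (new_at a) (iota 0 N).
Definition relabeling a : p.-tuple nat := [tuple rank a (index (tnth a u) a).+1 | u < p].

Lemma rankS a N : rank a N.+1 = (rank a N + new_at a N)%N.
Proof. by rewrite /rank -addn1 iotaD count_cat /= addn0. Qed.

Lemma leq_rank a M N : (M <= N)%N -> (rank a M <= rank a N)%N.
Proof. by move=> /subnKC<-; rewrite /rank iotaD count_cat leq_addr. Qed.

Lemma index_tnth_le a (u : 'I_p) : (index (tnth a u) a <= u)%N.
Proof. by rewrite (tnth_nth 0%N) index_nth // size_tuple. Qed.

Lemma new_at_index a x : x \in tval a -> new_at a (index x a).
Proof. by move=> xa; rewrite /new_at nth_index. Qed.

Lemma same_kernel_relabeling a : same_kernel (relabeling a) a.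
Proof.
move=> u v; rewrite !tnth_mktuple.
wlog le : u v / (index (tnth a u) a <= index (tnth a v) a)%N.
  by move=> H; case/orP: (leq_total (index (tnth a u) a) (index (tnth a v) a)) => /H //; rewrite eq_sym => ->; rewrite eq_sym.
move: le; rewrite leq_eqVlt => /orP[/eqP E|lt].
  rewrite E eqxx; apply/esym/eqP.
  by rewrite -(nth_index 0%N (mem_tnth u a)) E nth_index ?mem_tnth.
rewrite [RHS](_ : _ = false); last by apply/eqP => E; rewrite E ltnn in lt.
rewrite [rank _ (index (tnth a v) a).+1]rankS new_at_index ?mem_tnth // addn1.
by apply/negbTE; rewrite neq_ltn ltnS leq_rank.
Qed.

Lemma canonical_relabeling a : canonical_seq (relabeling a).
Proof.
have rank_le N : (N <= p)%N -> (rank a N <= \max_(v < p | (v < N)%N) tnth (relabeling a) v)%N.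
  elim: N => [|N IH] // Np; rewrite rankS; have [new|_] := boolP (new_at a N); last first.
    rewrite addn0; apply: leq_trans (IH (ltnW Np)) _.
    apply/bigmax_leqP => v vN; apply: (leq_bigmax_cond (F := fun v => tnth (relabeling a) v)).
    exact: ltnW.
  have -> : (rank a N + true)%N = tnth (relabeling a) (Ordinal Np).
    rewrite tnth_mktuple (tnth_nth 0%N) /= (eqP new) rankS.
    by rewrite new.
  exact: (leq_bigmax_cond (F := fun v => tnth (relabeling a) v)).
split=> [u|u u0|u u0]; rewrite tnth_mktuple.
- by rewrite rankS new_at_index ?mem_tnth // addn1.
- have E : index (tnth a u) a = 0%N.
    by apply/eqP; rewrite -leqn0; have := index_tnth_le a u; rewrite u0.
  by have := new_at_index (mem_tnth u a); rewrite E rankS => ->.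
- have := index_tnth_le a u; rewrite leq_eqVlt => /orP[/eqP E|lt].
    rewrite E rankS -addn1; apply: leq_add; last by case: new_at.
    exact: rank_le (ltnW (ltn_ord u)).
  apply/leqW; pose w := Ordinal (ltn_trans lt (ltn_ord u)).
  have -> : index (tnth a u) a = index (tnth a w) a.
    by rewrite [tnth a w](tnth_nth 0%N) /= nth_index // mem_tnth.
  rewrite -[rank _ _](tnth_mktuple (fun u => rank a (index (tnth a u) a).+1)).
  exact: (leq_bigmax_cond (F := fun v => tnth (relabeling a) v)).
Qed.

Lemma canonical_seqs1P b : canonical_seq b ->
  canonical_seqs1 (nb_values b) p b <-> exists i, paired_tree i b.
Proof.
move=> cb; split=> [[_ [i _ D]]|[i G]]; first by exists i; apply/Delta1_paired_tree.
have G' : paired_tree (relabeling i) b.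
  by apply: paired_tree_same_kernel G => // u v; rewrite same_kernel_relabeling.
split=> //; exists (relabeling i); last exact/Delta1_paired_tree.
split; first exact: canonical_relabeling.
by case/and3P: G' => _ _ /eqP <-; rewrite addKn.
Qed.

End CanonicalSequences.

Local Open Scope classical_set_scope.
Local Open Scope complex_scope.
Local Open Scope ring_scope.

(** * Expansion of the trace *)

Section ClosedPaths.
Variable K : comPzRingType.

Lemma big_tuple_cons (V : nmodType) (T : finType) q (F : q.+1.-tuple T -> V) :
  \sum_t F t = \sum_x \sum_(t : q.-tuple T) F (cons_tuple x t).
Proof.
rewrite pair_big /= (reindex (fun e : T * q.-tuple T => cons_tuple e.1 e.2)) //=.
exists (fun t => (thead t, behead_tuple t)) => [[x t] _|t _] /=.
  by congr (_, _); apply: val_inj.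
by rewrite [RHS]tuple_eta; apply: val_inj.
Qed.

Fixpoint path_weight (m : nat) (G : 'M[K]_m) (a : 'I_m) (s : seq 'I_m) : K :=
  if s is b :: s' then G a b * path_weight G b s' else 1.

Lemma expmx_path m (G : 'M[K]_m) q a b :
  (G ^+ q) a b = \sum_(t : q.-tuple 'I_m | last a t == b) path_weight G a t.
Proof.
elim: q a => [|q IH] a.
  rewrite expr0 mxE; have [->|ab] := eqVneq a b.
    rewrite (big_pred1 [tuple]) ?mulr1n // => t; rewrite tuple0 /=.
    by rewrite !eqxx.
  by rewrite big_pred0 // => t; rewrite tuple0 /= (negPf ab).
rewrite exprS mxE [RHS]big_mkcond big_tuple_cons; apply: eq_bigr => c _.
by rewrite IH big_distrr /= big_mkcond.
Qed.

Lemma mxtrace_exp m (G : 'M[K]_m) p : (0 < p)%N ->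
  \tr (G ^+ p) = \sum_(f : {ffun 'I_p -> 'I_m}) \prod_(u < p) G (f u) (f (ordS u)).
Proof.
case: p => // q _.
have E (t : q.+1.-tuple 'I_m) : path_weight G (tnth t ord_max) t =
    \prod_(u < q.+1) G (tnth t u) (tnth t (ordS u)).
  have H a s : path_weight G a s = \prod_(u < size s) G (nth a (a :: s) u) (nth a s u).
    elim: s a => [|b s IH] a /=; first by rewrite big_ord0.
    rewrite big_ord_recl /= IH; congr (_ * _); apply: eq_bigr => u _.
    congr (G _ _); last exact: set_nth_default.
    by case: (u : nat) (ltn_ord u) => //= v vs; apply: set_nth_default; apply: ltnW.
  rewrite H size_tuple (reindex_inj (@ordS_inj _)); apply: eq_bigr => u _.
  rewrite [RHS](congr2 _ (tnth_nth (tnth t ord_max) t u) (tnth_nth (tnth t ord_max) t (ordS u))).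
  congr (G _ _); rewrite /=.
  have := ltn_ord u; rewrite [(u < _)%N]ltnS leq_eqVlt => /orP[/eqP uE|uq].
    by rewrite uE modnn /=; apply: tnth_nth.
  by rewrite modn_small.
rewrite /mxtrace; under eq_bigr do rewrite expmx_path.
rewrite (exchange_big_dep xpredT) //=.
rewrite (reindex (fun f : {ffun 'I_q.+1 -> 'I_m} => [tuple f u | u < q.+1])); last first.
  exists (fun t => [ffun u => tnth t u]) => [f _|t _].
    by apply/ffunP => u; rewrite ffunE tnth_mktuple.
  by apply: eq_from_tnth => u; rewrite tnth_mktuple ffunE.
apply: eq_bigr => f _; pose t := [tuple f u | u < q.+1]; rewrite -/t.
rewrite (big_pred1 (tnth t ord_max)) => [|a].
  by rewrite E; apply: eq_bigr => u _; rewrite !tnth_mktuple.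
have -> : last a t = tnth t ord_max by rewrite (last_nth a) size_tuple (tnth_nth a).
exact: eq_sym.
Qed.

(** Passing from the [n ^ k]-dimensional matrix to the [m]-dimensional Gram
    matrix of the vectors, whose entries are products over the tensor factors. *)
Lemma mxtrace_exp_mulC N m (A : 'M[K]_(N, m)) (B : 'M[K]_(m, N)) p : (0 < p)%N ->
  \tr ((A *m B) ^+ p) = \tr ((B *m A) ^+ p).
Proof.
case: p => // q _.
have E : (A *m B) ^+ q.+1 = A *m ((B *m A) ^+ q *m B).
  elim: q => [|q IH]; first by rewrite expr1 expr0 mul1mx.
  rewrite exprS IH [(B *m A) ^+ q.+1]exprS.
  rewrite -[LHS]/((A *m B) *m (A *m ((B *m A) ^+ q *m B))).
  by rewrite -[X in _ = A *m (X *m B)]/((B *m A) *m (B *m A) ^+ q) !mulmxA.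
by rewrite E mxtrace_mulC exprSr -[in RHS]/((B *m A) ^+ q *m (B *m A)) -mulmxA.
Qed.

End ClosedPaths.

Section TensorTrace.
Local Open Scope sesquilinear_scope.
Variable R : realType.
Notation C := R[i].

Definition dotC n (u v : 'cV[C]_n) : C := \sum_j Num.conj (u j 0) * v j 0.

Lemma dotC_tens n1 n2 (u u' : 'cV[C]_n1) (v v' : 'cV[C]_n2) :
  @dotC (n1 * n2) (u *t v) (u' *t v') = dotC u u' * dotC v v'.
Proof.
rewrite /dotC mulr_sum; apply: eq_bigr => j _; rewrite !mxE !ord1 rmorphM /=.
by rewrite mulrACA.
Qed.

Lemma dotC_tensor n k (y z : 'I_k -> 'cV[C]_n) :
  dotC (tensor y) (tensor z) = \prod_l dotC (y l) (z l).
Proof.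
case: k y z => [|k] y z.
  rewrite big_ord0 /dotC /= big_ord1 !mxE.
  by rewrite rmorph1 mul1r.
rewrite /tensor; elim: k y z => [|k IH] y z.
  by rewrite big_ord1 /= .
by rewrite big_ord_recl /= dotC_tens IH.
Qed.

Variables (n k m : nat) (tau : nat -> R).

Lemma dotC_tensor_vector (x : 'I_m -> 'I_k -> 'I_n -> C) a b :
  dotC (tensor_vector x a) (tensor_vector x b) =
  \prod_(l < k) (n%:R^-1 * \sum_j Num.conj (x a l j) * x b l j).
Proof.
rewrite dotC_tensor; apply: eq_bigr => l _; rewrite /dotC big_distrr /=.
apply: eq_bigr => j _; rewrite !mxE rmorphM /=.
have -> : n%:R^-1 = ((Num.sqrt n%:R)^-1)%:C * ((Num.sqrt n%:R)^-1)%:C :> C.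
  rewrite -rmorphM /= -invfM -expr2 sqr_sqrtr ?ler0n //.
  by rewrite fmorphV rmorph_nat.
have -> : Num.conj ((Num.sqrt n%:R)^-1)%:C = ((Num.sqrt n%:R)^-1)%:C :> C.
  by rewrite conj_Creal // complex_real.
ring.
Qed.

Lemma trace_tensor_matrix (x : 'I_m -> 'I_k -> 'I_n -> C) p : (0 < p)%N ->
  \tr (tensor_matrix tau x ^+ p) =
  \sum_(f : {ffun 'I_p -> 'I_m}) (\prod_(u < p) tau (f u))%:C *
    n%:R^-1 ^+ (p * k) *
    \sum_(g : {ffun 'I_k -> {ffun 'I_p -> 'I_n}})
      \prod_(l < k) \prod_(u < p)
        (Num.conj (x (f u) l (g l u)) * x (f (ordS u)) l (g l u)).
Proof.
move=> p0; pose A := \matrix_(j, a) tensor_vector x a j 0.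
pose B := \matrix_(a < m) ((tau a)%:C *: (tensor_vector x a)^t*).
have -> : tensor_matrix tau x = A *m B.
  apply/matrixP => s t; rewrite summxE !mxE; apply: eq_bigr => a _; rewrite !mxE.
  by rewrite big_ord1 !mxE; ring.
rewrite mxtrace_exp_mulC // mxtrace_exp //; apply: eq_bigr => f _.
have -> : \prod_(u < p) (B *m A) (f u) (f (ordS u)) =
  \prod_(u < p) ((tau (f u))%:C * \prod_(l < k)
    (n%:R^-1 * \sum_j Num.conj (x (f u) l j) * x (f (ordS u)) l j)).
  apply: eq_bigr => u _; rewrite -dotC_tensor_vector !mxE big_distrr /=.
  by apply: eq_bigr => j _; rewrite !mxE; ring.
rewrite big_split /= -rmorph_prod -mulrA; congr (_ * _).
rewrite exchange_big /=.
under eq_bigr do rewrite big_split /= prodr_const card_ord bigA_distr_bigA /=.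
rewrite big_split /= prodr_const card_ord -exprM; congr (_ * _).
by rewrite bigA_distr_bigA.
Qed.

End TensorTrace.

(** * Expectations of complex random variables *)

Section ComplexParts.
Variable R : realType.
Implicit Types z w : R[i].
Local Notation Re := complex.Re.
Local Notation Im := complex.Im.

Lemma ReD z w : Re (z + w) = Re z + Re w. Proof. by case: z w => [a b] [c d]. Qed.
Lemma ImD z w : Im (z + w) = Im z + Im w. Proof. by case: z w => [a b] [c d]. Qed.
Lemma ReM z w : Re (z * w) = Re z * Re w - Im z * Im w.
Proof. by case: z w => [a b] [c d]. Qed.
Lemma ImM z w : Im (z * w) = Re z * Im w + Im z * Re w.
Proof. by case: z w => [a b] [c d]. Qed.
Lemma Re_conjc z : Re (Num.conj z) = Re z. Proof. by case: z. Qed.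
Lemma Im_conjc z : Im (Num.conj z) = - Im z. Proof. by case: z. Qed.
Lemma complex_eq z w : Re z = Re w -> Im z = Im w -> z = w.
Proof. by case: z w => [a b] [c d] /= -> ->. Qed.

Lemma normc_leP z (M : R) : 0 <= M ->
  (`|z| <= M%:C) = (Re z ^+ 2 + Im z ^+ 2 <= M ^+ 2).
Proof.
move=> M0; rewrite normc_def lecR -[X in _ <= X]ger0_norm // -sqrtr_sqr.
by rewrite ler_sqrt ?sqr_ge0.
Qed.

Lemma norm_Re_le z (M : R) : 0 <= M -> `|z| <= M%:C -> `|Re z| <= M.
Proof.
move=> M0; rewrite normc_leP // => H; rewrite -(@ler_pXn2r _ 2) ?nnegrE //.
by rewrite real_normK ?num_real //; have := sqr_ge0 (Im z); lra.
Qed.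

Lemma norm_Im_le z (M : R) : 0 <= M -> `|z| <= M%:C -> `|Im z| <= M.
Proof.
move=> M0; rewrite normc_leP // => H; rewrite -(@ler_pXn2r _ 2) ?nnegrE //.
by rewrite real_normK ?num_real //; have := sqr_ge0 (Re z); lra.
Qed.

Lemma norm_le_parts z (M : R) : 0 <= M -> `|Re z| <= M -> `|Im z| <= M -> `|z| <= (M *+ 2)%:C.
Proof.
move=> M0 HR HI; rewrite normc_leP ?mulrn_wge0 // -[Re z ^+ 2]real_normK ?num_real //.
rewrite -[Im z ^+ 2]real_normK ?num_real //.
have := normr_ge0 (Re z); have := normr_ge0 (Im z); nra.
Qed.

End ComplexParts.

Section ComplexRV.
Context {d : measure_display} {T : measurableType d} {R : realType}.
Implicit Types Z W : T -> R[i].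
Local Notation Re := complex.Re.
Local Notation Im := complex.Im.

Lemma complex_RV_Re Z : complex_RV Z -> measurable_fun setT (fun w => Re (Z w)).
Proof. by move=> mZ; apply: (measurableT_comp measurable_fst mZ). Qed.

Lemma complex_RV_Im Z : complex_RV Z -> measurable_fun setT (fun w => Im (Z w)).
Proof. by move=> mZ; apply: (measurableT_comp measurable_snd mZ). Qed.

Lemma complex_RV_parts Z : measurable_fun setT (fun w => Re (Z w)) ->
  measurable_fun setT (fun w => Im (Z w)) -> complex_RV Z.
Proof. by move=> mR mI; apply: measurable_fun_pair. Qed.

Lemma complex_RV_cst (c : R[i]) : complex_RV (fun _ : T => c).
Proof. exact: measurable_cst. Qed.

Lemma complex_RV_add Z W : complex_RV Z -> complex_RV W -> complex_RV (fun w => Z w + W w).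
Proof.
move=> mZ mW; apply: complex_RV_parts.
  under eq_fun do rewrite ReD.
  by apply: measurable_funD; apply: complex_RV_Re.
under eq_fun do rewrite ImD.
by apply: measurable_funD; apply: complex_RV_Im.
Qed.

Lemma complex_RV_mul Z W : complex_RV Z -> complex_RV W -> complex_RV (fun w => Z w * W w).
Proof.
move=> mZ mW; apply: complex_RV_parts.
  under eq_fun do rewrite ReM.
  by apply: measurable_funB; apply: measurable_funM;
    (apply: complex_RV_Re || apply: complex_RV_Im).
under eq_fun do rewrite ImM.
by apply: measurable_funD; apply: measurable_funM;
  (apply: complex_RV_Re || apply: complex_RV_Im).
Qed.

Lemma complex_RV_conj Z : complex_RV Z -> complex_RV (fun w => Num.conj (Z w)).
Proof.
move=> mZ; apply: complex_RV_parts.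
  by under eq_fun do rewrite Re_conjc; apply: complex_RV_Re.
under eq_fun do rewrite Im_conjc.
by apply: measurable_funN; apply: complex_RV_Im.
Qed.

Lemma complex_RV_sum (J : Type) (s : seq J) (Q : pred J) (F : J -> T -> R[i]) :
  (forall j, complex_RV (F j)) -> complex_RV (fun w => \sum_(j <- s | Q j) F j w).
Proof.
move=> mF; elim: s => [|j s IH].
  by under eq_fun do rewrite big_nil; apply: complex_RV_cst.
under eq_fun do rewrite big_cons; case: (Q j) => //.
exact: complex_RV_add.
Qed.

Lemma complex_RV_prod (J : Type) (s : seq J) (Q : pred J) (F : J -> T -> R[i]) :
  (forall j, complex_RV (F j)) -> complex_RV (fun w => \prod_(j <- s | Q j) F j w).
Proof.
move=> mF; elim: s => [|j s IH].
  by under eq_fun do rewrite big_nil; apply: complex_RV_cst.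
under eq_fun do rewrite big_cons; case: (Q j) => //.
exact: complex_RV_mul.
Qed.

Lemma complex_RV_exp Z k : complex_RV Z -> complex_RV (fun w => Z w ^+ k).
Proof.
move=> mZ; elim: k => [|k IH]; first exact: complex_RV_cst.
by under eq_fun do rewrite exprS; apply: complex_RV_mul.
Qed.

Lemma complex_RV_indic (A : set T) : measurable A -> complex_RV (fun w => (\1_A w : R)%:C).
Proof.
by move=> mA; apply: complex_RV_parts => /=; [exact: measurable_indic|exact: measurable_cst].
Qed.

(** Boundedness holds everywhere and not only almost surely: it makes all the
    integrability conditions below automatic. *)
Definition bounded_RV Z := complex_RV Z /\ exists M : R, forall w, `|Z w| <= M%:C.

Lemma bounded_RV_cst (c : R[i]) : bounded_RV (fun _ => c).
Proof.
split; first exact: complex_RV_cst.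
by exists (Re `|c|) => _; rewrite RRe_real // normr_real.
Qed.

Lemma bounded_RV_add Z W : bounded_RV Z -> bounded_RV W -> bounded_RV (fun w => Z w + W w).
Proof.
move=> [mZ [M ZM]] [mW [N WN]]; split; first exact: complex_RV_add.
exists (M + N) => w; rewrite rmorphD /=; apply: le_trans (ler_normD _ _) _.
exact: lerD.
Qed.

Lemma bounded_RV_mul Z W : bounded_RV Z -> bounded_RV W -> bounded_RV (fun w => Z w * W w).
Proof.
move=> [mZ [M ZM]] [mW [N WN]]; split; first exact: complex_RV_mul.
by exists (M * N) => w; rewrite rmorphM /= normrM ler_pM.
Qed.

Lemma bounded_RV_conj Z : bounded_RV Z -> bounded_RV (fun w => Num.conj (Z w)).
Proof.
move=> [mZ [M ZM]]; split; first exact: complex_RV_conj.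
by exists M => w; rewrite norm_conjC.
Qed.

Lemma bounded_RV_sum (J : Type) (s : seq J) (Q : pred J) (F : J -> T -> R[i]) :
  (forall j, bounded_RV (F j)) -> bounded_RV (fun w => \sum_(j <- s | Q j) F j w).
Proof.
move=> mF; elim: s => [|j s IH].
  by under eq_fun do rewrite big_nil; apply: bounded_RV_cst.
under eq_fun do rewrite big_cons; case: (Q j) => //.
exact: bounded_RV_add.
Qed.

Lemma bounded_RV_prod (J : Type) (s : seq J) (Q : pred J) (F : J -> T -> R[i]) :
  (forall j, bounded_RV (F j)) -> bounded_RV (fun w => \prod_(j <- s | Q j) F j w).
Proof.
move=> mF; elim: s => [|j s IH].
  by under eq_fun do rewrite big_nil; apply: bounded_RV_cst.
under eq_fun do rewrite big_cons; case: (Q j) => //.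
exact: bounded_RV_mul.
Qed.

Lemma bounded_RV_indic (A : set T) : measurable A -> bounded_RV (fun w => (\1_A w : R)%:C).
Proof.
move=> mA; split; first exact: complex_RV_indic.
exists 1 => w; rewrite indicE; case: (w \in A) => /=; rewrite ?normr0 ?ler01 ?normr1 //.
Qed.

End ComplexRV.

Section ComplexExpectation.
Context {d : measure_display} {T : measurableType d} {R : realType}.
Variable P : probability T R.
Implicit Types Z W : T -> R[i].
Local Notation Re := complex.Re.
Local Notation Im := complex.Im.
Local Notation E := (complex_expectation P).

Lemma Re_expectation Z : Re (E Z) = \int[P]_w Re (Z w).
Proof. by rewrite /complex_expectation /= unlock. Qed.

Lemma Im_expectation Z : Im (E Z) = \int[P]_w Im (Z w).
Proof. by rewrite /complex_expectation /= unlock. Qed.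

Lemma bounded_fun_integrable (f : T -> R) M : measurable_fun setT f ->
  (forall w, `|f w| <= M) -> P.-integrable setT (EFin \o f).
Proof.
move=> mf fM; apply: measurable_bounded_integrable => //.
  by rewrite (le_lt_trans (probability_le1 P measurableT)) ?ltry.
by exists M; split; [exact: num_real|move=> N MN w _; apply: le_trans (fM w) _; exact: ltW].
Qed.

Lemma integrable_Re Z : bounded_RV Z -> P.-integrable setT (EFin \o (fun w => Re (Z w))).
Proof.
move=> [mZ [M ZM]]; apply: (@bounded_fun_integrable _ `|M|); first exact: complex_RV_Re.
move=> w; apply: norm_Re_le => //; apply: le_trans (ZM w) _.
by rewrite lecR ler_norm.
Qed.

Lemma integrable_Im Z : bounded_RV Z -> P.-integrable setT (EFin \o (fun w => Im (Z w))).
Proof.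
move=> [mZ [M ZM]]; apply: (@bounded_fun_integrable _ `|M|); first exact: complex_RV_Im.
move=> w; apply: norm_Im_le => //; apply: le_trans (ZM w) _.
by rewrite lecR ler_norm.
Qed.

Lemma complex_expectationD Z W : bounded_RV Z -> bounded_RV W ->
  E (fun w => Z w + W w) = E Z + E W.
Proof.
move=> bZ bW; apply: complex_eq; rewrite ?ReD ?ImD ?Re_expectation ?Im_expectation.
  rewrite -RintegralD //; try exact: integrable_Re.
  by apply: eq_Rintegral => w _; rewrite ReD.
rewrite -RintegralD //; try exact: integrable_Im.
by apply: eq_Rintegral => w _; rewrite ImD.
Qed.

Lemma complex_expectationZ (c : R[i]) Z : bounded_RV Z -> E (fun w => c * Z w) = c * E Z.
Proof.
move=> bZ; apply: complex_eq; rewrite ?ReM ?ImM ?Re_expectation ?Im_expectation.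
  rewrite -!RintegralZl //; try exact: integrable_Re; try exact: integrable_Im.
  rewrite -RintegralB //; last 2 first.
  - exact: (integrableZl measurableT (Re c) (integrable_Re bZ)).
  - exact: (integrableZl measurableT (Im c) (integrable_Im bZ)).
  by apply: eq_Rintegral => w _; rewrite ReM.
rewrite -!RintegralZl //; try exact: integrable_Re; try exact: integrable_Im.
rewrite -RintegralD //; last 2 first.
- exact: (integrableZl measurableT (Re c) (integrable_Im bZ)).
- exact: (integrableZl measurableT (Im c) (integrable_Re bZ)).
by apply: eq_Rintegral => w _; rewrite ImM.
Qed.

Lemma fine_probability_setT : fine (P setT) = 1.
Proof. by have -> : P setT = 1%E by exact: probability_setT. Qed.

Lemma complex_expectation_cst (c : R[i]) : E (fun _ => c) = c.
Proof.
apply: complex_eq; rewrite ?Re_expectation ?Im_expectation Rintegral_cst //.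
  by rewrite fine_probability_setT mulr1.
by rewrite fine_probability_setT mulr1.
Qed.

Lemma complex_expectation_sum (J : Type) (s : seq J) (Q : pred J) (F : J -> T -> R[i]) :
  (forall j, bounded_RV (F j)) ->
  E (fun w => \sum_(j <- s | Q j) F j w) = \sum_(j <- s | Q j) E (F j).
Proof.
move=> bF; elim: s => [|j s IH].
  by rewrite big_nil; under eq_fun do rewrite big_nil; apply: complex_expectation_cst.
rewrite big_cons; under eq_fun do rewrite big_cons; case: (Q j) => //.
by rewrite complex_expectationD ?IH //; apply: bounded_RV_sum.
Qed.

Lemma complex_expectation_indic (A : set T) : measurable A ->
  E (fun w => (\1_A w : R)%:C) = (fine (P A))%:C.
Proof.
move=> mA; apply: complex_eq; rewrite ?Re_expectation ?Im_expectation /=.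
  by rewrite /Rintegral integral_indic // setIT.
by rewrite Rintegral_cst // mul0r.
Qed.

(** [`|E Z| ^+ 2] is the real part of [E (conj (E Z) * Z)], hence at most
    [`|E Z| * M] by monotonicity of the real integral. *)
Lemma norm_complex_expectation_le Z (M : R) : complex_RV Z -> (forall w, `|Z w| <= M%:C) ->
  `|E Z| <= M%:C.
Proof.
move=> mZ ZM.
have M0 : 0 <= M.
  have [[w _]|nT] := pselect (exists w : T, True); first by rewrite -lecR; apply: le_trans (normr_ge0 _) (ZM w).
  have := fine_probability_setT; rewrite (_ : setT = set0) ?measure0.
    by move=> /eqP; rewrite eq_sym oner_eq0.
  by apply/seteqP; split => w // _; exfalso; apply: nT; exists w.
have bZ : bounded_RV Z by split => //; exists M.
have [->|E0] := eqVneq (E Z) 0; first by rewrite normr0 ler0c.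
have N0 : 0 < `|E Z| by rewrite normr_gt0.
rewrite -(ler_pM2l N0) -expr2 sqr_normc.
have ErE : `|E Z| = (Re `|E Z|)%:C by rewrite RRe_real // normr_real.
move: (Re `|E Z|) ErE => r ErE; rewrite ErE.
have r0 : 0 <= r by rewrite -ler0c -ErE.
rewrite -rmorphM /=.
have -> : E Z * (E Z)^* = (Re (E (fun w => Num.conj (E Z) * Z w)))%:C.
  rewrite complex_expectationZ //; case: (E Z) => a b.
  by apply: complex_eq; rewrite ?ReM ?ImM /= ?ReM /=; ring.
rewrite lecR Re_expectation.
have bW : bounded_RV (fun w => Num.conj (E Z) * Z w).
  by apply: bounded_RV_mul => //; apply: bounded_RV_cst.
apply: (@le_trans _ _ (\int[P]_w (r * M))); last first.
  by rewrite Rintegral_cst // fine_probability_setT mulr1.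
apply: le_Rintegral => //; first exact: integrable_Re.
  by apply: (@bounded_fun_integrable _ `|r * M|) => //.
move=> w _; apply: le_trans (ler_norm _) _; apply: norm_Re_le; first exact: mulr_ge0.
by rewrite normrM norm_conjC ErE rmorphM /= ler_pM // ler0c.
Qed.

End ComplexExpectation.

(** * Expectations of products of independent variables *)

Section LayerCake.
Variable R : realType.
Local Notation Re := complex.Re.
Local Notation Im := complex.Im.

(** The number of integers in [1, M] up to [y] is the integral part of [y]. *)
Lemma layer_cake (M : nat) (y : R) : 0 <= y <= M%:R ->
  0 <= y - \sum_(a < M) (a.+1%:R <= y)%R%:R <= 1.
Proof.
elim: M => [|M IH] /andP[y0 yM]; first by rewrite big_ord0; lra.
rewrite big_ord_recr /=; have [yM'|My] := lerP y M%:R.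
  have := IH; rewrite y0 yM' => /(_ isT).
  suff -> : (M.+1%:R <= y) = false by rewrite addr0.
  by apply/negbTE; rewrite -ltNge; apply: le_lt_trans yM' _; rewrite ltr_nat.
rewrite (eq_bigr (fun=> 1)); last first.
  move=> a _; suff -> : a.+1%:R <= y by [].
  by apply: le_trans (ltW My); rewrite ler_nat.
rewrite sumr_const card_ord; have -> : (M.+1%:R : R) = M%:R + 1 by rewrite -natr1.
rewrite -natr1 in yM.
by case: (lerP (M%:R + 1) y) => ?; rewrite /= ?mulr1n ?mulr0n; lra.
Qed.

Definition of_pair (q : R * R) : R[i] := q.1 +i* q.2.

Lemma complex_pairK (z : R[i]) : of_pair (complex_pair z) = z.
Proof. by case: z. Qed.

Variable N : nat.
Hypothesis N_gt0 : (0 < N)%N.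

Definition level : finType := ('I_1 + ('I_(N + N) + 'I_(N + N)))%type.

Definition level_coef (g : level) : R[i] := match g with
  | inl _ => (- 1) +i* (- 1) | inr (inl _) => N%:R^-1 +i* 0 | inr (inr _) => 0 +i* N%:R^-1
  end.

Definition level_set (h : R[i] -> R[i]) (g : level) : set (R * R) := match g with
  | inl _ => setT
  | inr (inl a) => [set q | a.+1%:R <= (Re (h (of_pair q)) + 1) * N%:R]
  | inr (inr a) => [set q | a.+1%:R <= (Im (h (of_pair q)) + 1) * N%:R]
  end.

(** A uniform approximation of [h], bounded by 1, as a finite combination of
    indicators, obtained from the layer-cake formula for the real and imaginary
    parts of [h + 1 + 'i].  The index type [level N] does not depend on [h], so that
    a product of such sums expands over finite functions. *)
Definition discretized (h : R[i] -> R[i]) (z : R[i]) : R[i] :=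
  \sum_(g : level) level_coef g * (\1_(level_set h g) (complex_pair z) : R)%:C.

Lemma discretized_close h z : (forall z, `|h z| <= 1) ->
  `|h z - discretized h z| <= (N%:R^-1 *+ 2)%:C.
Proof.
move=> h1; have NR : 0 < N%:R :> R by rewrite ltr0n.
have Re1 : `|Re (h z)| <= 1 by apply: norm_Re_le.
have Im1 : `|Im (h z)| <= 1 by apply: norm_Im_le.
have dE : discretized h z =
   (- 1 + N%:R^-1 * \sum_(a < N + N) (a.+1%:R <= (Re (h z) + 1) * N%:R)%R%:R) +i*
   (- 1 + N%:R^-1 * \sum_(a < N + N) (a.+1%:R <= (Im (h z) + 1) * N%:R)%R%:R).
  rewrite /discretized big_sumType big_sumType /= big_ord1 indicT mulr1.
  have E1 F : \sum_(a < N + N) (N%:R^-1 +i* 0) * (F a)%:C = (N%:R^-1 * \sum_(a < N + N) F a) +i* 0 :> R[i].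
    by rewrite -mulr_sumr -rmorph_sum; apply: complex_eq; rewrite ?ReM ?ImM /=; ring.
  have E2 F : \sum_(a < N + N) (0 +i* N%:R^-1) * (F a)%:C = 0 +i* (N%:R^-1 * \sum_(a < N + N) F a) :> R[i].
    by rewrite -mulr_sumr -rmorph_sum; apply: complex_eq; rewrite ?ReM ?ImM /=; ring.
  rewrite E1 E2; apply: complex_eq; rewrite ?ReD ?ImD /= ?addr0 ?add0r.
    congr (_ + _ * _); apply: eq_bigr => a _; rewrite indicE; congr (nat_of_bool _)%:R.
    by apply/idP/idP; rewrite inE /= complex_pairK.
  congr (_ + _ * _); apply: eq_bigr => a _; rewrite indicE; congr (nat_of_bool _)%:R.
  by apply/idP/idP; rewrite inE /= complex_pairK.
have close (r : R) : `|r| <= 1 ->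
    `|r - (- 1 + N%:R^-1 * \sum_(a < N + N) (a.+1%:R <= (r + 1) * N%:R)%R%:R)| <= N%:R^-1.
  rewrite ler_norml => /andP[r1 r2].
  have := @layer_cake (N + N) ((r + 1) * N%:R).
  set S := \sum_(_ < _) _; rewrite natrD => H.
  have {}H : 0 <= (r + 1) * N%:R - S <= 1 by apply: H; apply/andP; split; nra.
  rewrite (_ : r - _ = N%:R^-1 * ((r + 1) * N%:R - S)); last by field; lra.
  have Ni : 0 <= N%:R^-1 :> R by rewrite invr_ge0 ltW.
  by case/andP: H => H0 H1; rewrite normrM (ger0_norm H0) (ger0_norm Ni) ler_piMr.
rewrite dE; apply: norm_le_parts; first by rewrite invr_ge0 ltW.
  by have := close _ Re1; case: (h z) => a b.
by have := close _ Im1; case: (h z) => a b.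
Qed.

End LayerCake.

Section ProductComparison.
Variable K : numDomainType.

(** The bound is linear in [e], which will tend to zero for a fixed index set. *)
Lemma prod_close (J : Type) (s : seq J) (a b : J -> K) (e : K) : 0 <= e <= 1 ->
  (forall j, `|a j| <= 1) -> (forall j, `|a j - b j| <= e) ->
  `|\prod_(j <- s) a j - \prod_(j <- s) b j| <= (size s * 2 ^ size s)%:R * e.
Proof.
move=> /andP[e0 e1] a1 ab.
have b2 j : `|b j| <= 2.
  rewrite -[b j](subrK (a j)) (le_trans (ler_normD _ _)) // (natrD _ 1 1) lerD //.
  by rewrite distrC (le_trans (ab j)).
have bs : `|\prod_(j <- s) b j| <= (2 ^ size s)%:R.
  elim: s => [|j s IH]; first by rewrite big_nil normr1.
  by rewrite big_cons normrM expnS natrM ler_pM.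
elim: s bs => [|j s IH] bs; first by rewrite !big_nil subrr normr0 mul0r.
have bs' : `|\prod_(j <- s) b j| <= (2 ^ size s)%:R.
  elim: (s) => [|i s' IH']; first by rewrite big_nil normr1.
  by rewrite big_cons normrM expnS natrM ler_pM.
rewrite !big_cons.
rewrite (_ : _ - _ = a j * (\prod_(j <- s) a j - \prod_(j <- s) b j)
                     + (a j - b j) * \prod_(j <- s) b j); last by ring.
rewrite (le_trans (ler_normD _ _)) // !normrM.
apply: (@le_trans _ _ ((size s * 2 ^ size s)%:R * e + e * (2 ^ size s)%:R)).
  apply: lerD; last exact: ler_pM.
  by rewrite -[leRHS]mul1r ler_pM // IH.
rewrite [e * _]mulrC -mulrDl ler_wpM2r // -natrD ler_nat /= -mulSnr leq_mul2l /=.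
by rewrite leq_exp2l.
Qed.

End ProductComparison.

Lemma eq_of_close (R : realType) (z w : R[i]) (K : R) :
  (forall N, (0 < N)%N -> `|z - w| <= (K * N%:R^-1)%:C) -> z = w.
Proof.
move=> H; apply/eqP; rewrite -subr_eq0 -normr_eq0; apply/eqP.
have rE : `|z - w| = (complex.Re `|z - w|)%:C by rewrite RRe_real // normr_real.
rewrite rE in H *; move: (complex.Re _) rE H => r rE H.
have r0 : 0 <= r by rewrite -ler0c -rE.
congr (_%:C); apply/eqP; rewrite eq_le r0 andbT leNgt; apply/negP => rgt0.
have [N N0 NK] : exists2 N, (0 < N)%N & K / r < N%:R.
  exists (Num.truncn (`|K / r|)).+1 => //; apply: le_lt_trans (ler_norm _) _.
  by apply: truncnS_gt.
have := H N N0; rewrite lecR leNgt => /negP; apply.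
by rewrite ltr_pdivrMr ?ltr0n // mulrC -ltr_pdivrMr.
Qed.

Section Independence.
Context {d : measure_display} {T : measurableType d} {R : realType}.
Variable P : probability T R.
Local Notation E := (complex_expectation P).

Definition borel_fun (h : R[i] -> R[i]) := complex_RV (h \o @of_pair R).

Lemma complex_RV_comp (h : R[i] -> R[i]) (Z : T -> R[i]) :
  borel_fun h -> complex_RV Z -> complex_RV (fun w => h (Z w)).
Proof.
move=> mh mZ; have := measurableT_comp mh mZ.
by congr (measurable_fun _ _); apply/funext => w /=; rewrite complex_pairK.
Qed.

Lemma measurable_level_set (N : nat) h (g : level N) : borel_fun h -> measurable (level_set h g).
Proof.
have ge_set (f : R * R -> R) (t : R) : measurable_fun setT f ->
    measurable [set q | t <= (f q + 1) * N%:R].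
  move=> mf; have mg : measurable_fun setT (fun q => t <= (f q + 1) * N%:R).
    apply: measurable_fun_ler; first exact: measurable_cst.
    apply: measurable_funM; last exact: measurable_cst.
    by apply: measurable_funD => //; exact: measurable_cst.
  by have := mg measurableT [set true] I; rewrite setTI.
move=> mh; case: g => [_|[a|a]] /=; first exact: measurableT.
  exact: ge_set (complex_RV_Re mh).
exact: ge_set (complex_RV_Im mh).
Qed.

Lemma measurable_level_event (N : nat) h (g : level N) (Z : T -> R[i]) :
  borel_fun h -> complex_RV Z ->
  measurable [set w | level_set h g (complex_pair (Z w))].
Proof.
move=> mh mZ; rewrite -[X in measurable X]setTI.
exact: (mZ measurableT _ (measurable_level_set g mh)).
Qed.

Lemma bounded_discretized (N : nat) h (Z : T -> R[i]) : borel_fun h -> complex_RV Z ->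
  bounded_RV (fun w => discretized N h (Z w)).
Proof.
move=> mh mZ; apply: bounded_RV_sum => g; apply: bounded_RV_mul.
  exact: bounded_RV_cst.
exact: bounded_RV_indic (measurable_level_event g mh mZ).
Qed.

Lemma expectation_discretized (N : nat) h (Z : T -> R[i]) : borel_fun h -> complex_RV Z ->
  E (fun w => discretized N h (Z w)) =
  \sum_(g : level N) level_coef R g *
    (fine (P [set w | level_set h g (complex_pair (Z w))]))%:C.
Proof.
move=> mh mZ; rewrite /discretized complex_expectation_sum => [|g]; last first.
  apply: bounded_RV_mul; first exact: bounded_RV_cst.
  exact: bounded_RV_indic (measurable_level_event g mh mZ).
apply: eq_bigr => g _; rewrite complex_expectationZ; last first.
  exact: bounded_RV_indic (measurable_level_event g mh mZ).
by rewrite -(complex_expectation_indic P (measurable_level_event g mh mZ)).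
Qed.

Lemma expectation_discretized_close (N : nat) h (Z : T -> R[i]) : (0 < N)%N ->
  borel_fun h -> (forall z, `|h z| <= 1) -> complex_RV Z ->
  `|E (fun w => h (Z w)) - E (fun w => discretized N h (Z w))| <= (N%:R^-1 *+ 2)%:C.
Proof.
move=> N0 mh h1 mZ.
have bh : bounded_RV (fun w => h (Z w)).
  by split; [exact: complex_RV_comp|exists 1 => w; apply: h1].
have bd := bounded_discretized N mh mZ.
rewrite -mulN1r -complex_expectationZ // -complex_expectationD //; last first.
  by apply: bounded_RV_mul => //; apply: bounded_RV_cst.
apply: norm_complex_expectation_le => [|w]; last by rewrite mulN1r discretized_close.
have [//] : bounded_RV (fun w => h (Z w) + -1 * discretized N h (Z w)).
by apply: bounded_RV_add => //; apply: bounded_RV_mul => //; apply: bounded_RV_cst.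
Qed.

Variables (J : finType) (Z : J -> T -> R[i]).
Hypothesis Z_indep : mutually_independent P Z.
Hypothesis Z_meas : forall j, complex_RV (Z j).

(** For combinations of indicators, independence of events is exactly what the
    expanded product requires. *)
Lemma expectation_prod_discretized (N : nat) (h : J -> R[i] -> R[i]) :
  (forall j, borel_fun (h j)) ->
  E (fun w => \prod_j discretized N (h j) (Z j w)) =
  \prod_j E (fun w => discretized N (h j) (Z j w)).
Proof.
move=> mh; pose A (f : {ffun J -> level N}) : set T :=
  [set w | forall j, level_set (h j) (f j) (complex_pair (Z j w))].
have mA f : measurable (A f).
  have -> : A f = \bigcap_j [set w | level_set (h j) (f j) (complex_pair (Z j w))].
    by apply/seteqP; split => w /= H j; [move=> _; exact: H|exact: H].
  apply: fin_bigcap_measurable => // j _.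
  exact: measurable_level_event.
have -> : (fun w => \prod_j discretized N (h j) (Z j w)) =
   (fun w => \sum_(f : {ffun J -> level N})
      (\prod_j level_coef R (f j)) * (\1_(A f) w : R)%:C).
  apply/funext => w; rewrite /discretized bigA_distr_bigA /=.
  apply: eq_bigr => f _; rewrite big_split /=; congr (_ * _).
  rewrite -rmorph_prod; congr (_%:C); rewrite indicE.
  have [/set_mem Aw|nA] := boolP (w \in A f).
    by rewrite big1 // => j _; rewrite indicE mem_set //; apply: Aw.
  have [j nj] : exists j, ~ level_set (h j) (f j) (complex_pair (Z j w)).
    by apply/existsNP => H; move/negP: nA; apply; rewrite inE.
  by rewrite (bigD1 j) //= indicE memNset // mul0r.
rewrite complex_expectation_sum => [|f]; last first.
  by apply: bounded_RV_mul; [exact: bounded_RV_cst|exact: bounded_RV_indic].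
under [RHS]eq_bigr do rewrite expectation_discretized //.
rewrite bigA_distr_bigA /=; apply: eq_bigr => f _.
rewrite complex_expectationZ; last exact: bounded_RV_indic.
rewrite complex_expectation_indic // big_split /=; congr (_ * _).
have -> := Z_indep (fun j => measurable_level_set (f j) (mh j)).
rewrite -rmorph_prod; congr (_%:C).
transitivity (fine (\prod_(j : J)
    (fine (P [set w | level_set (h j) (f j) (complex_pair (Z j w))]))%:E)%E).
  congr fine; apply: eq_bigr => j _; rewrite fineK //.
  by apply: fin_num_measure; apply: measurable_level_event.
by rewrite prodEFin.
Qed.

Lemma expectation_prod_indep (h : J -> R[i] -> R[i]) :
  (forall j, borel_fun (h j)) -> (forall j z, `|h j z| <= 1) ->
  E (fun w => \prod_j h j (Z j w)) = \prod_j E (fun w => h j (Z j w)).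
Proof.
move=> mh h1; pose K : R := (#|J| * 2 ^ #|J|)%:R.
apply: (@eq_of_close _ _ _ (K *+ 8)) => N N0.
(* The discretization with parameter [N + N] has error at most [1 / N]. *)
pose M := (N + N)%N; have M0 : (0 < M)%N by rewrite addn_gt0 N0.
have MN : M%:R^-1 *+ 2 = N%:R^-1 :> R.
  have NR : 0 < N%:R :> R by rewrite ltr0n.
  by rewrite /M natrD; field; apply/andP; split; lra.
have N1 : 0 <= (N%:R^-1 : R)%:C <= 1.
  by rewrite ler0c invr_ge0 ler0n -[X in _ <= X]/(1%:C) lecR invf_le1 ?ltr0n ?ler1n.
have bd j := bounded_discretized M (mh j) (Z_meas j).
have bh j : bounded_RV (fun w => h j (Z j w)).
  by split; [exact: complex_RV_comp|exists 1 => w; apply: h1].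
have KE : (size (index_enum J) * 2 ^ size (index_enum J))%:R * (N%:R^-1 : R)%:C = (K * N%:R^-1)%:C.
  have -> : size (index_enum J) = #|J| by rewrite -sum1_size sum1_card.
  have Kc : K%:C = (#|J| * 2 ^ #|J|)%:R :> R[i] by exact: (rmorph_nat (real_complex R)).
  by rewrite -Kc; apply/esym; exact: (rmorphM (real_complex R)).
have pw w : `|\prod_j h j (Z j w) - \prod_j discretized M (h j) (Z j w)| <= (K * N%:R^-1)%:C.
  rewrite -KE; apply: prod_close => // j.
  by rewrite -MN discretized_close.
have close1 : `|E (fun w => \prod_j h j (Z j w)) -
    E (fun w => \prod_j discretized M (h j) (Z j w))| <= (K * N%:R^-1)%:C.
  have b1 := bounded_RV_prod (index_enum J) xpredT bh.
  have b2 := bounded_RV_prod (index_enum J) xpredT bd.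
  have b3 := bounded_RV_mul (bounded_RV_cst (-1)) b2.
  rewrite -mulN1r -complex_expectationZ // -complex_expectationD //.
  apply: norm_complex_expectation_le => [|w]; last by rewrite mulN1r pw.
  by have [] := bounded_RV_add b1 b3.
have close2 : `|\prod_j E (fun w => h j (Z j w)) -
    \prod_j E (fun w => discretized M (h j) (Z j w))| <= (K * N%:R^-1)%:C.
  rewrite -KE; apply: prod_close => // j; last first.
    by rewrite -MN expectation_discretized_close.
  by apply: norm_complex_expectation_le; [exact: complex_RV_comp|move=> w; apply: h1].
move: close1; rewrite expectation_prod_discretized // => close1.
rewrite distrC in close2; rewrite -[X in `|X|](subrKA (\prod_j E (fun w => discretized M (h j) (Z j w)))).
apply: le_trans (ler_normD _ _) (le_trans (lerD close1 close2) _).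
rewrite -rmorphD lecR mulrnAl.
have : 0 <= K * N%:R^-1 by rewrite mulr_ge0 ?invr_ge0 ?ler0n.
lra.
Qed.

End Independence.

(** The expectation of a discretization involves only the probabilities of
    events determined by the variable. *)
Lemma expectation_same_law (R : realType) d (T : measurableType d) d' (T' : measurableType d')
    (P : probability T R) (P' : probability T' R) (Z : T -> R[i]) (Z' : T' -> R[i])
    (h : R[i] -> R[i]) :
  complex_RV Z -> complex_RV Z' -> same_law P Z P' Z' ->
  borel_fun h -> (forall z, `|h z| <= 1) ->
  complex_expectation P (fun w => h (Z w)) = complex_expectation P' (fun w => h (Z' w)).
Proof.
move=> mZ mZ' law mh h1; apply: (@eq_of_close _ _ _ 4) => N N0.
have close := expectation_discretized_close P N0 mh h1 mZ.
have close' := expectation_discretized_close P' N0 mh h1 mZ'.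
have dE : complex_expectation P (fun w => discretized N h (Z w)) =
          complex_expectation P' (fun w => discretized N h (Z' w)).
  rewrite !expectation_discretized //; apply: eq_bigr => g _.
  by rewrite law //; apply: measurable_level_set.
rewrite dE in close; rewrite distrC in close'.
rewrite -[X in `|X|](subrKA (complex_expectation P' (fun w => discretized N h (Z' w)))).
apply: le_trans (ler_normD _ _) (le_trans (lerD close close') _).
rewrite -rmorphD lecR.
have : 0 <= N%:R^-1 :> R by rewrite invr_ge0 ler0n.
lra.
Qed.

(** * The expected trace *)

(** Collecting the factors that refer to the same entry. *)
Lemma prod_regroup (K : comPzRingType) p m n (f : 'I_p -> 'I_m) (g : 'I_p -> 'I_n)
    (F : 'I_m -> 'I_n -> K) :
  \prod_(u < p) F (f u) (g u) =
  \prod_(x < m) \prod_(y < n) F x y ^+ (\sum_(u < p) ((f u == x) && (g u == y)))%N.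
Proof.
under [RHS]eq_bigr do under eq_bigr do rewrite -prodrXr.
under [RHS]eq_bigr do rewrite exchange_big /=.
rewrite [RHS]exchange_big /=; apply: eq_bigr => u _.
rewrite (bigD1 (f u)) //= (bigD1 (g u)) //= !eqxx expr1.
rewrite big1 => [|y /negPf yg]; last by rewrite eq_sym yg.
rewrite big1 => [|x /negPf xf]; last by rewrite big1 // => y _; rewrite eq_sym xf.
by rewrite !mulr1.
Qed.

Section Clipping.
Variable R : realType.
Local Notation C := R[i].

(** Replacing an entry by its clipped version changes it on a null set only and
    makes [|z| = 1] hold everywhere. *)
Definition clip (z : C) : C := if `|z| == 1 then z else 1.

Lemma norm_clip z : `|clip z| = 1.
Proof. by rewrite /clip; case: eqP => // _; rewrite normr1. Qed.

Definition clip_monomial (x y : nat) (z : C) : C := Num.conj (clip z) ^+ x * clip z ^+ y.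

Lemma norm_clip_monomial x y z : `|clip_monomial x y z| = 1.
Proof. by rewrite normrM !normrX norm_conjC norm_clip !expr1n mulr1. Qed.

Lemma clip_monomialSS x y z : clip_monomial x.+1 y.+1 z = clip_monomial x y z.
Proof.
rewrite /clip_monomial !exprS mulrACA [Num.conj _ * _]mulrC -normCK norm_clip.
by rewrite expr1n mul1r.
Qed.

Lemma borel_fun_id : borel_fun (@id C).
Proof. by apply: complex_RV_parts => /=; [exact: measurable_fst|exact: measurable_snd]. Qed.

Lemma unit_circle_measurable : measurable [set q : R * R | `|of_pair q| == 1].
Proof.
have -> : [set q : R * R | `|of_pair q| == 1] = [set q | q.1 * q.1 + q.2 * q.2 == 1].
  apply/seteqP; split => -[a b] /=; rewrite normc_def /= -!expr2 => /eqP.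
    by move=> [] /(congr1 (fun x => x ^+ 2)); rewrite expr1n sqr_sqrtr ?addr_ge0 ?sqr_ge0 // => ->.
  by move=> ->; rewrite sqrtr1.
have mf : measurable_fun setT (fun q : R * R => q.1 * q.1 + q.2 * q.2 == 1).
  apply: measurable_fun_eqr; last exact: measurable_cst.
  by apply: measurable_funD; apply: measurable_funM;
    (exact: measurable_fst || exact: measurable_snd).
by have := mf measurableT [set true] I; rewrite setTI.
Qed.

Lemma borel_fun_clip : borel_fun clip.
Proof.
have mb : measurable_fun setT (fun q : R * R => `|of_pair q| == 1).
  apply: (measurable_fun_bool true); rewrite setTI.
  exact: unit_circle_measurable.
have := measurable_fun_ifT mb borel_fun_id (complex_RV_cst (1 : C)).
congr (measurable_fun _ _); apply/funext => q /=.
by rewrite /clip /=; case: ifP.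
Qed.

Lemma borel_fun_clip_monomial x y : borel_fun (clip_monomial x y).
Proof.
apply: complex_RV_mul; apply: complex_RV_exp; last exact: borel_fun_clip.
by apply: complex_RV_conj; apply: borel_fun_clip.
Qed.

End Clipping.

Section AlmostSure.
Context {d : measure_display} {T : measurableType d} {R : realType}.
Variable P : probability T R.

Lemma eq_expectation_ae (Z W : T -> R[i]) : complex_RV Z -> complex_RV W ->
  (\forall w \ae P, Z w = W w) -> complex_expectation P Z = complex_expectation P W.
Proof.
move=> mZ mW ZW; apply: complex_eq; rewrite ?Re_expectation ?Im_expectation.
  congr fine; apply: ae_eq_integral => //.
  - by apply/measurable_EFinP; apply: complex_RV_Re.
  - by apply/measurable_EFinP; apply: complex_RV_Re.
  - by apply: filterS ZW => w -> _.
congr fine; apply: ae_eq_integral => //.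
- by apply/measurable_EFinP; apply: complex_RV_Im.
- by apply/measurable_EFinP; apply: complex_RV_Im.
- by apply: filterS ZW => w -> _.
Qed.

Lemma expectation_conj (Z : T -> R[i]) : bounded_RV Z ->
  complex_expectation P (fun w => Num.conj (Z w)) = Num.conj (complex_expectation P Z).
Proof.
move=> bZ; apply: complex_eq; rewrite ?Re_conjc ?Im_conjc ?Re_expectation ?Im_expectation.
  by apply: eq_Rintegral => w _; rewrite Re_conjc.
rewrite -mulN1r -RintegralZl //; last exact: integrable_Im.
by apply: eq_Rintegral => w _; rewrite Im_conjc mulN1r.
Qed.

(** Having modulus 1 almost surely is a property of the law. *)
Lemma ae_same_law d' (T' : measurableType d') (P' : probability T' R)
    (Z : T -> R[i]) (Z' : T' -> R[i]) (B : set (R * R)) :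
  complex_RV Z -> complex_RV Z' -> same_law P Z P' Z' -> measurable B ->
  (\forall w \ae P', B (complex_pair (Z' w))) -> \forall w \ae P, B (complex_pair (Z w)).
Proof.
move=> mZ mZ' law mB ae'.
have mE' : measurable [set w | (~` B) (complex_pair (Z' w))].
  by have := mZ' measurableT _ (measurableC mB); rewrite setTI.
have mE : measurable [set w | (~` B) (complex_pair (Z w))].
  by have := mZ measurableT _ (measurableC mB); rewrite setTI.
have E0 : P' [set w | (~` B) (complex_pair (Z' w))] = 0%E.
  exact: (negligibleP P' mE').1 ae'.
exact: (negligibleP P mE).2 (etrans (law _ (measurableC mB)) E0).
Qed.

End AlmostSure.

Section EntryMoments.
Context {d0 : measure_display} {T0 : measurableType d0} {R : realType}.
Variables (P0 : probability T0 R) (xi1 : T0 -> R[i]).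
Hypothesis xi1_meas : complex_RV xi1.
Hypothesis xi1_centered : complex_expectation P0 xi1 = 0.
Hypothesis xi1_unit : \forall w \ae P0, `|xi1 w| = 1.

Definition entry_moment (x y : nat) : R[i] :=
  complex_expectation P0 (fun w => clip_monomial x y (xi1 w)).

Lemma entry_moment00 : entry_moment 0 0 = 1.
Proof.
rewrite /entry_moment /clip_monomial; under eq_fun do rewrite !expr0 mul1r.
exact: complex_expectation_cst.
Qed.

Lemma entry_momentSS x y : entry_moment x.+1 y.+1 = entry_moment x y.
Proof. by rewrite /entry_moment; under eq_fun do rewrite clip_monomialSS. Qed.

Lemma bounded_clip_xi1 : bounded_RV (fun w => clip (xi1 w)).
Proof.
split; first by apply: complex_RV_comp => //; apply: borel_fun_clip.
by exists 1 => w; rewrite norm_clip.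
Qed.

Lemma entry_moment01 : entry_moment 0 1 = 0.
Proof.
rewrite -xi1_centered; apply: eq_expectation_ae => //.
  by apply: complex_RV_comp => //; apply: borel_fun_clip_monomial.
apply: filterS xi1_unit => w w1; rewrite /clip_monomial expr0 expr1 mul1r.
by rewrite /clip w1 eqxx.
Qed.

Lemma entry_moment10 : entry_moment 1 0 = 0.
Proof.
have := entry_moment01; rewrite /entry_moment /clip_monomial.
under eq_fun do rewrite expr0 expr1 mul1r.
under [in X in _ -> X]eq_fun do rewrite expr0 expr1 mulr1.
rewrite expectation_conj; last exact: bounded_clip_xi1.
by move=> ->; rewrite rmorph0.
Qed.

Lemma entry_moment_le1 x y : `|entry_moment x y| <= 1.
Proof.
apply: (@norm_complex_expectation_le _ _ _ _ _ 1) => [|w].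
  by apply: complex_RV_comp => //; apply: borel_fun_clip_monomial.
by rewrite norm_clip_monomial.
Qed.

Context {d : measure_display} {T : measurableType d}.
Variables (P : probability T R) (n k m p : nat).
Variables (xi : 'I_m -> 'I_k -> 'I_n -> T -> R[i]) (tau : nat -> R).
Hypothesis p_gt0 : (0 < p)%N.
Hypothesis xi_meas : forall a l j, complex_RV (xi a l j).
Hypothesis xi_law : forall a l j, same_law P (xi a l j) P0 xi1.
Hypothesis xi_indep : mutually_independent P
  (fun v : 'I_m * 'I_k * 'I_n => xi v.1.1 v.1.2 v.2).

Lemma expectation_clip_word (f : {ffun 'I_p -> 'I_m}) (g : {ffun 'I_k -> {ffun 'I_p -> 'I_n}}) :
  complex_expectation P (fun w => \prod_(l < k) \prod_(u < p)
     (Num.conj (clip (xi (f u) l (g l u) w)) * clip (xi (f (ordS u)) l (g l u) w))) =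
  \prod_(l < k) weight entry_moment f (g l).
Proof.
pose h (v : 'I_m * 'I_k * 'I_n) : R[i] -> R[i] := clip_monomial
  (down_count f (g v.1.2) v.1.1 v.2) (up_count f (g v.1.2) v.1.1 v.2).
have triple (F : 'I_m -> 'I_k -> 'I_n -> R[i]) :
    \prod_(l < k) \prod_(x < m) \prod_(y < n) F x l y =
    \prod_(v : 'I_m * 'I_k * 'I_n) F v.1.1 v.1.2 v.2.
  rewrite exchange_big /= pair_big /=.
  by rewrite (pair_big xpredT xpredT (fun q y => F q.1 q.2 y)).
transitivity (complex_expectation P (fun w => \prod_v h v (xi v.1.1 v.1.2 v.2 w))).
  congr complex_expectation; apply/funext => w; rewrite -(triple (fun x l y => h (x, l, y) (xi x l y w))).
  apply: eq_bigr => l _; rewrite big_split /=.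
  rewrite (prod_regroup f (g l) (fun x y => Num.conj (clip (xi x l y w)))).
  rewrite (prod_regroup (fun u => f (ordS u)) (g l) (fun x y => clip (xi x l y w))).
  by rewrite -big_split; apply: eq_bigr => x _; rewrite -big_split.
rewrite (expectation_prod_indep xi_indep) //; last 2 first.
- by move=> v; apply: borel_fun_clip_monomial.
- by move=> v z; rewrite norm_clip_monomial.
rewrite /weight triple; apply: eq_bigr => v _.
apply: expectation_same_law => //; first exact: borel_fun_clip_monomial.
by move=> z; rewrite norm_clip_monomial.
Qed.

Lemma complex_RV_trace (x : 'I_m -> 'I_k -> 'I_n -> T -> R[i]) :
  (forall a l j, complex_RV (x a l j)) ->
  complex_RV (fun w => \tr (tensor_matrix tau (fun a l j => x a l j w) ^+ p)).
Proof.
move=> mx; under eq_fun do rewrite trace_tensor_matrix //.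
apply: complex_RV_sum => f; apply: complex_RV_mul; first exact: complex_RV_cst.
apply: complex_RV_sum => g; apply: complex_RV_prod => l; apply: complex_RV_prod => u.
by apply: complex_RV_mul => //; apply: complex_RV_conj.
Qed.

Lemma expectation_trace :
  complex_expectation P (fun w => \tr (tensor_matrix tau (fun a l j => xi a l j w) ^+ p)) =
  \sum_(f : {ffun 'I_p -> 'I_m}) (\prod_(u < p) tau (f u))%:C * n%:R^-1 ^+ (p * k) *
     (\sum_(io : {ffun 'I_p -> 'I_n}) weight entry_moment f io) ^+ k.
Proof.
have mclip a l j : complex_RV (fun w => clip (xi a l j w)).
  by apply: complex_RV_comp => //; apply: borel_fun_clip.
rewrite (@eq_expectation_ae _ _ _ _ _
    (fun w => \tr (tensor_matrix tau (fun a l j => clip (xi a l j w)) ^+ p))); last first.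
- pose same (v : 'I_m * 'I_k * 'I_n) : set T :=
    [set w | clip (xi v.1.1 v.1.2 v.2 w) = xi v.1.1 v.1.2 v.2 w].
  have ae v : \forall w \ae P, same v w.
    have ae0 : \forall w \ae P0, [set q : R * R | `|of_pair q| == 1] (complex_pair (xi1 w)).
      by apply: filterS xi1_unit => w w1; rewrite /= complex_pairK w1.
    have := ae_same_law (xi_meas v.1.1 v.1.2 v.2) xi1_meas (xi_law v.1.1 v.1.2 v.2)
      (@unit_circle_measurable R) ae0.
    by apply: filterS => w /=; rewrite complex_pairK /same /= /clip => ->.
  apply: filterS (@filter_forall _ _ same _ _ ae) => w H.
  congr (\tr (_ ^+ p)); congr tensor_matrix.
  by apply/funext => a; apply/funext => l; apply/funext => j; rewrite (H (a, l, j) : clip _ = _).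
- exact: complex_RV_trace.
- exact: complex_RV_trace.
under eq_fun do rewrite trace_tensor_matrix //.
have bclip a l j : bounded_RV (fun w => clip (xi a l j w)).
  by split => //; exists 1 => w; rewrite norm_clip.
have bword f g : bounded_RV (fun w => \prod_(l < k) \prod_(u < p)
     (Num.conj (clip (xi ((f : {ffun 'I_p -> 'I_m}) u) l ((g : {ffun 'I_k -> {ffun 'I_p -> 'I_n}}) l u) w)) * clip (xi (f (ordS u)) l (g l u) w))).
  apply: bounded_RV_prod => l; apply: bounded_RV_prod => u.
  by apply: bounded_RV_mul => //; apply: bounded_RV_conj.
rewrite complex_expectation_sum => [|f]; last first.
  apply: bounded_RV_mul; first exact: bounded_RV_cst.
  by apply: bounded_RV_sum => g; apply: bword.
apply: eq_bigr => f _; rewrite complex_expectationZ; last first.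
  by apply: bounded_RV_sum => g; apply: bword.
congr (_ * _); rewrite complex_expectation_sum; last by move=> g; apply: bword.
under eq_bigr do rewrite expectation_clip_word.
rewrite -(bigA_distr_bigA (fun l io => weight entry_moment f io)) /=.
by rewrite prodr_const card_ord.
Qed.

End EntryMoments.

(** * Sums over injections *)

Section BigLimits.
Variables (K : numFieldType) (I : Type) (F : set_system I).
Hypothesis FF : Filter F.

Lemma cvg_sum_seq (J : eqType) (r : seq J) (f : J -> I -> K^o) (l : J -> K^o) :
  (forall j, j \in r -> f j x @[x --> F] --> l j) ->
  \sum_(j <- r) f j x @[x --> F] --> (\sum_(j <- r) l j : K^o).
Proof.
elim: r => [|j r IH] H.
  by under eq_fun do rewrite big_nil; rewrite big_nil; apply: cvg_cst.
under eq_fun do rewrite big_cons; rewrite big_cons; apply: cvgD.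
  by apply: H; rewrite mem_head.
by apply: IH => i ir; apply: H; rewrite inE ir orbT.
Qed.

Lemma cvg_prod_seq (J : eqType) (r : seq J) (f : J -> I -> K^o) (l : J -> K^o) :
  (forall j, j \in r -> f j x @[x --> F] --> l j) ->
  \prod_(j <- r) f j x @[x --> F] --> (\prod_(j <- r) l j : K^o).
Proof.
elim: r => [|j r IH] H.
  by under eq_fun do rewrite big_nil; rewrite big_nil; apply: cvg_cst.
under eq_fun do rewrite big_cons; rewrite big_cons; apply: cvgM.
  by apply: H; rewrite mem_head.
by apply: IH => i ir; apply: H; rewrite inE ir orbT.
Qed.

End BigLimits.

Section EmpiricalMoments.
Variables (R : realType) (tau : nat -> R) (mtau : nat -> R).
Hypothesis htau : forall q : nat, (0 < q)%N ->
  (fun m : nat => m%:R^-1 * \sum_(j < m) tau j ^+ q) @ \oo --> mtau q.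

Lemma cvg_invn : (fun M : nat => M%:R^-1 : R) @ \oo --> (0 : R).
Proof. by rewrite -cvg_shiftS; apply: cvg_harmonic. Qed.

(** [|t|^q <= 1 + t^(2q)], and the empirical moments of even order converge. *)
Lemma abs_moment_bounded q : (0 < q)%N ->
  exists2 B : R, 0 <= B & forall m, m%:R^-1 * \sum_(j < m) `|tau j| ^+ q <= B.
Proof.
move=> q0; have q20 : (0 < q + q)%N by rewrite addn_gt0 q0.
have /cvg_seq_bounded : cvgn (fun m : nat => m%:R^-1 * \sum_(j < m) tau j ^+ (q + q)).
  by apply/cvg_ex; exists (mtau (q + q)); apply: htau.
move=> [B0' [_ hB0]]; pose B := B0' + 1.
have hB m : `|m%:R^-1 * \sum_(j < m) tau j ^+ (q + q)| <= B.
  by apply: (hB0 B _ m I); rewrite ltrDl ltr01.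
have B0 : 0 <= B by apply: le_trans (hB 0%N).
exists (1 + B); first by rewrite addr_ge0.
move=> m; apply: (@le_trans _ _ (m%:R^-1 * \sum_(j < m) (1 + tau j ^+ (q + q)))).
  apply: ler_wpM2l; first by rewrite invr_ge0 ler0n.
  apply: ler_sum => j _; rewrite exprD -expr2 -normrX -[X in _ <= 1 + X]real_normK ?num_real //.
  have := normr_ge0 (tau j ^+ q); nra.
rewrite big_split /= mulrDr lerD //; last exact: le_trans (ler_norm _) (hB m).
rewrite sumr_const card_ord; have [->|m0] := posnP m; first by rewrite mulr0n mulr0.
by rewrite mulVf // pnatr_eq0 -lt0n.
Qed.

Variables (s : nat) (dg : 'I_s -> nat).
Hypothesis dg_gt0 : forall t, (0 < dg t)%N.

Lemma prod_moments (g : nat -> R) (M : nat) :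
  M%:R^-1 ^+ s * \sum_(h : {ffun 'I_s -> 'I_M}) \prod_(t < s) g (h t) ^+ dg t =
  \prod_(t < s) (M%:R^-1 * \sum_(j < M) g j ^+ dg t).
Proof.
rewrite big_split /= prodr_const card_ord; congr (_ * _).
by rewrite (bigA_distr_bigA (fun t (j : 'I_M) => g j ^+ dg t)).
Qed.

Lemma abs_sum_bounded : exists2 B : R, 0 <= B & forall M,
  M%:R^-1 ^+ s * \sum_(h : {ffun 'I_s -> 'I_M}) \prod_(t < s) `|tau (h t)| ^+ dg t <= B.
Proof.
have /fin_all_exists2[B B0 BM] := fun t => abs_moment_bounded (dg_gt0 t).
exists (\prod_(t < s) B t); first exact: prodr_ge0.
move=> M; rewrite (prod_moments (fun j => `|tau j|)); apply: ler_prod => t _.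
by rewrite BM andbT mulr_ge0 ?invr_ge0 ?ler0n // sumr_ge0.
Qed.

(** Identifying two of the [s] indices leaves [s - 1] free sums, against a
    normalization by [M ^ s]. *)
Lemma collision_bounded (t t' : 'I_s) : t != t' -> exists2 B : R, 0 <= B & forall M,
  M%:R^-1 ^+ s * \sum_(h : {ffun 'I_s -> 'I_M} | h t == h t')
     \prod_(r < s) `|tau (h r)| ^+ dg r <= B * M%:R^-1.
Proof.
move=> tt'; have /fin_all_exists2[B B0 BM] := fun r => abs_moment_bounded (dg_gt0 r).
have [B' B'0 B'M] := @abs_moment_bounded (dg t + dg t') (ltn_addr _ (dg_gt0 t)).
exists (B' * \prod_(r < s | (r != t) && (r != t')) B r).
  by rewrite mulr_ge0 // prodr_ge0.
move=> M.
have -> : \sum_(h : {ffun 'I_s -> 'I_M} | h t == h t') \prod_(r < s) `|tau (h r)| ^+ dg r =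
   (\sum_(j < M) `|tau j| ^+ (dg t + dg t')) *
   \prod_(r < s | (r != t) && (r != t')) (\sum_(j < M) `|tau j| ^+ dg r).
  (* [j] is the common value at [t] and [t']; the constraint is put into the factors
     so that the sum over [h] factorizes. *)
  pose a (j : 'I_M) r (x : 'I_M) := if (r == t) || (r == t') then
     (if x == j then `|tau x| ^+ dg r else 0) else `|tau x| ^+ dg r.
  (* Only [j = h t] contributes to the inner sum for a given [h]. *)
  transitivity (\sum_(j < M) \sum_(h : {ffun 'I_s -> 'I_M}) \prod_(r < s) a j r (h r)).
    rewrite exchange_big /= big_mkcond /=; apply: eq_bigr => h _.
    rewrite (bigD1 (h t)) //= [X in _ + X]big1 ?addr0; last first.
      move=> j jt; rewrite (bigD1 t) //= /a eqxx /=.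
      by rewrite eq_sym (negPf jt) mul0r.
    have [E|E] := eqVneq (h t) (h t').
      apply: eq_bigr => r _; rewrite /a.
      case: (eqVneq r t) => [->|_] /=; first by rewrite eqxx.
      by case: (eqVneq r t') => [->|_] //=; rewrite E eqxx.
    rewrite (bigD1 t') //= {1}/a eqxx orbT.
    by rewrite [h t' == _]eq_sym (negPf E) mul0r.
  rewrite mulr_suml; apply: eq_bigr => j _.
  rewrite -(bigA_distr_bigA (a j)) /= (bigD1 t) //= (bigD1 t') 1?eq_sym //= mulrA.
  congr (_ * _); last first.
    by apply: eq_bigr => r /andP[rt rt']; rewrite /a (negPf rt) (negPf rt').
  rewrite exprD; congr (_ * _); rewrite (bigD1 j) //= /a !eqxx ?orbT /= big1 ?addr0 //.
    by move=> x /negPf ->.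
  by move=> x /negPf ->.
have sE : s = (1 + (1 + #|[pred r : 'I_s | (r != t) && (r != t')]|))%N.
  rewrite -[LHS]card_ord (cardD1 t) inE (cardD1 t') !inE [t' == t]eq_sym tt' /=.
  by congr (1 + (1 + _))%N; apply: eq_card => r; rewrite !inE andbT andbC.
have -> : M%:R^-1 ^+ s = (M%:R^-1 * M%:R^-1) *
    \prod_(r < s | (r != t) && (r != t')) M%:R^-1 :> R.
  by rewrite prodr_const {1}sE !exprD !expr1 mulrA.
set S' := \sum_(j < M) _; set PS := \prod_(r < s | _) \sum_(j < M) _; set PM := \prod_(r < s | _) _.
have -> : M%:R^-1 * M%:R^-1 * PM * (S' * PS) = (M%:R^-1 * S') * (PM * PS) * M%:R^-1 by ring.
have M0 : 0 <= M%:R^-1 :> R by rewrite invr_ge0 ler0n.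
apply: ler_wpM2r => //; rewrite -big_split /=; apply: ler_pM => //.
- by rewrite mulr_ge0 // sumr_ge0.
- by apply: prodr_ge0 => r _; rewrite mulr_ge0 // sumr_ge0.
- by apply: ler_prod => r _; rewrite BM andbT mulr_ge0 // sumr_ge0.
Qed.

Lemma noninjective_sum_bounded : exists2 B : R, 0 <= B & forall M,
  M%:R^-1 ^+ s * \sum_(h : {ffun 'I_s -> 'I_M} | ~~ injectiveb h)
     \prod_(r < s) `|tau (h r)| ^+ dg r <= B * M%:R^-1.
Proof.
have ex (q : 'I_s * 'I_s) : exists B, 0 <= B /\ (q.1 != q.2 -> forall M,
  M%:R^-1 ^+ s * \sum_(h : {ffun 'I_s -> 'I_M} | h q.1 == h q.2)
     \prod_(r < s) `|tau (h r)| ^+ dg r <= B * M%:R^-1).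
  have [->|tt'] := eqVneq q.1 q.2; first by exists 0.
  by have [B B0 BM] := collision_bounded tt'; exists B.
have /fin_all_exists[B BP] := ex.
exists (\sum_(q | q.1 != q.2) B q); first by apply: sumr_ge0 => q _; case: (BP q).
move=> M; rewrite mulr_suml.
apply: (@le_trans _ _ (\sum_(q : 'I_s * 'I_s | q.1 != q.2) M%:R^-1 ^+ s *
   \sum_(h : {ffun 'I_s -> 'I_M} | h q.1 == h q.2) \prod_(r < s) `|tau (h r)| ^+ dg r)).
  rewrite -mulr_sumr; apply: ler_wpM2l; first by rewrite exprn_ge0 // invr_ge0 ler0n.
  rewrite (exchange_big_dep xpredT) //= big_mkcond /=; apply: ler_sum => h _.
  have P0 : 0 <= \prod_(r < s) `|tau (h r)| ^+ dg r by apply: prodr_ge0 => r _; rewrite exprn_ge0.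
  case: ifPn => [/injectivePn[t [t' tt' htt']]|_]; last exact: sumr_ge0.
  by rewrite (bigD1 (t, t')) /= ?tt' ?htt' ?eqxx // lerDl sumr_ge0.
by apply: ler_sum => q qq; case: (BP q) => _ /(_ qq).
Qed.

Lemma cvg_injective_sum :
  (fun M : nat => M%:R^-1 ^+ s * \sum_(h : {ffun 'I_s -> 'I_M} | injectiveb h)
     \prod_(t < s) tau (h t) ^+ dg t) @ \oo --> (\prod_(t < s) mtau (dg t) : R).
Proof.
have [B B0 BM] := noninjective_sum_bounded.
pose rest M := M%:R^-1 ^+ s * \sum_(h : {ffun 'I_s -> 'I_M} | ~~ injectiveb h)
     \prod_(t < s) tau (h t) ^+ dg t.
have rest0 : rest @ \oo --> (0 : R).
  apply/norm_cvg0P; apply: (@squeeze_cvgr _ _ _ _ (fun=> 0) (fun M => B * M%:R^-1)).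
  - near=> M; rewrite normr_ge0 /=; apply: le_trans (BM M).
    have Mi : 0 <= M%:R^-1 ^+ s :> R by rewrite exprn_ge0 // invr_ge0 ler0n.
    rewrite /rest normrM (ger0_norm Mi); apply: ler_wpM2l => //.
    apply: le_trans (ler_norm_sum _ _ _) _; apply: ler_sum => h _.
    by rewrite normr_prod; apply: ler_prod => t _; rewrite normrX lexx exprn_ge0.
  - exact: cvg_cst.
  - by rewrite -(mulr0 B); apply: cvgM; [exact: cvg_cst|exact: cvg_invn].
have all_cvg : (fun M : nat => \prod_(t < s) (M%:R^-1 * \sum_(j < M) tau j ^+ dg t)) @ \oo -->
    (\prod_(t < s) mtau (dg t) : R).
  by apply: cvg_prod_seq => t _; apply: htau.
rewrite -[X in _ --> X]subr0.
have -> : (fun M : nat => M%:R^-1 ^+ s * \sum_(h : {ffun 'I_s -> 'I_M} | injectiveb h)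
     \prod_(t < s) tau (h t) ^+ dg t) =
   (fun M => \prod_(t < s) (M%:R^-1 * \sum_(j < M) tau j ^+ dg t) - rest M).
  apply/funext => M; rewrite -(prod_moments tau) /rest -mulrBr; congr (_ * _).
  by rewrite [X in X - _](bigID (fun h : {ffun 'I_s -> 'I_M} => injectiveb h)) /= addrK.
exact: cvgB.
Unshelve. all: by end_near.
Qed.

End EmpiricalMoments.

(** * Sums over canonical classes *)

Section CanonicalClasses.
Variables (p : nat) (b : p.-tuple nat).
Hypothesis cb : canonical_seq b.
Local Notation s := (nb_values b).

Lemma canonical_label_proof (u : 'I_p) : ((tnth b u).-1 < s)%N.
Proof.
by have := mem_tnth u b; rewrite mem_canonical // => /andP[t0 ts]; rewrite prednK.
Qed.

(** The values of a canonical sequence are 1, ..., s; shifted by one they become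
    the indices of the injections into [m]. *)
Definition canonical_label (u : 'I_p) : 'I_s := Ordinal (canonical_label_proof u).

Lemma canonical_labelE u : (canonical_label u).+1 = tnth b u.
Proof. by rewrite /= prednK //; case: cb. Qed.

Lemma canonical_label_eq u v : (canonical_label u == canonical_label v) = (tnth b u == tnth b v).
Proof. by rewrite -!canonical_labelE eqSS. Qed.

Lemma canonical_label_surj t : exists u, canonical_label u = t.
Proof.
have : t.+1 \in tval b by rewrite mem_canonical //= ltn_ord.
by case/tnthP=> u uE; exists u; apply: val_inj; rewrite /= -uE.
Qed.

Lemma deg_canonical_gt0 (t : 'I_s) : (0 < deg b t.+1)%N.
Proof. by rewrite -has_count has_pred1 mem_canonical //= ltn_ord. Qed.

Lemma prod_canonical_label (K : comPzRingType) (F : 'I_s -> K) :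
  \prod_(u < p) F (canonical_label u) = \prod_(t < s) F t ^+ deg b t.+1.
Proof.
rewrite (partition_big canonical_label xpredT) //=; apply: eq_bigr => t _.
rewrite (eq_bigr (fun=> F t)) => [|u /eqP-> //]; rewrite prodr_const; congr (_ ^+ _).
rewrite /deg -sum1_count big_tuple sum1_card; apply: eq_card => u.
by rewrite !unfold_in /= -canonical_labelE.
Qed.

Lemma same_kernel_of_relabeling a : relabeling a = b -> same_kernel b a.
Proof. by move=> <-; apply: same_kernel_relabeling. Qed.

(** The index choices with canonical form [b] are the injective relabelings of
    [b]. *)
Lemma sum_canonical_class (K : comPzRingType) (g : nat -> K) (M : nat) :
  \sum_(f : {ffun 'I_p -> 'I_M} | relabeling (nat_tuple f) == b) \prod_(u < p) g (f u) =
  \sum_(h : {ffun 'I_s -> 'I_M} | injectiveb h) \prod_(t < s) g (h t) ^+ deg b t.+1.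
Proof.
have -> : \sum_(f : {ffun 'I_p -> 'I_M} | relabeling (nat_tuple f) == b) \prod_(u < p) g (f u) =
  \sum_(f : {ffun 'I_p -> 'I_M} | [forall u, forall v,
     (canonical_label u == canonical_label v) ==> (f u == f v)])
   (if relabeling (nat_tuple f) == b then \prod_(u < p) g (f u) else 0).
  rewrite -big_mkcondr; apply: eq_bigl => f; apply/esym/andb_idl => /eqP cf.
  apply/forallP => u; apply/forallP => v; apply/implyP.
  by rewrite canonical_label_eq (same_kernel_of_relabeling cf) !tnth_mktuple.
rewrite (sum_ffun_comp _ canonical_label_surj) [RHS]big_mkcond /=; apply: eq_bigr => h _.
have -> : (relabeling (nat_tuple [ffun u => h (canonical_label u)]) == b) = injectiveb h.
  apply/eqP/injectiveP => [cf t t' htt'|h_inj].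
    have [u uE] := canonical_label_surj t; have [v vE] := canonical_label_surj t'.
    apply/eqP; rewrite -uE -vE canonical_label_eq (same_kernel_of_relabeling cf).
    by rewrite !tnth_mktuple !ffunE uE vE htt'.
  apply: canonical_unique => //; first exact: canonical_relabeling.
  move=> u v; rewrite same_kernel_relabeling !tnth_mktuple !ffunE -canonical_label_eq.
  by rewrite (inj_eq val_inj) (inj_eq h_inj).
case: ifP => // _; rewrite -(prod_canonical_label (fun t => g (h t))).
by apply: eq_bigr => u _; rewrite ffunE.
Qed.

End CanonicalClasses.

Lemma big_pred1_uniq (V : nmodType) (J : eqType) (r : seq J) (j : J) (F : J -> V) :
  uniq r -> \sum_(i <- r | i == j) F i = if j \in r then F j else 0.
Proof.
move=> r_uniq; rewrite big_mkcond; case: ifPn => jr.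
  by rewrite (bigD1_seq j) //= eqxx big1 ?addr0 // => i /negPf->.
by rewrite big1_seq // => i /andP[_ ir]; case: eqP => // ij; rewrite -ij ir in jr.
Qed.

Section CanonicalList.
Variable p : nat.
Hypothesis p_gt0 : (0 < p)%N.

(** An explicit enumeration, because the theorem sums over sets of tuples of
    arbitrary natural numbers. *)
Definition canonical_list : seq (p.-tuple nat) :=
  [seq b <- [seq map_tuple val a | a <- enum {: p.-tuple 'I_p.+1}] | `[< canonical_seq b >]].

Lemma canonical_list_uniq : uniq canonical_list.
Proof.
apply: filter_uniq; rewrite map_inj_uniq ?enum_uniq // => a a' /(congr1 val) /= E.
by apply: val_inj; apply: (inj_map val_inj).
Qed.

Lemma nb_values_le (b : p.-tuple nat) : (nb_values b <= p)%N.
Proof. by rewrite /nb_values (leq_trans (size_undup _)) // size_tuple. Qed.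

Lemma nb_values_gt0 (b : p.-tuple nat) : (0 < nb_values b)%N.
Proof.
rewrite /nb_values -has_predT; apply/hasP; exists (tnth b (Ordinal p_gt0)) => //.
by rewrite mem_undup mem_tnth.
Qed.

Lemma mem_canonical_list b : (b \in canonical_list) <-> canonical_seq b.
Proof.
rewrite mem_filter; split=> [/andP[/asboolP]//|cb]; rewrite asboolT //=.
apply/mapP; exists [tuple inord (tnth b u) | u < p]; first by rewrite mem_enum.
apply: eq_from_tnth => u; rewrite tnth_map tnth_mktuple inordK //.
have := mem_tnth u b; rewrite mem_canonical // => /andP[_ le].
by rewrite ltnS (leq_trans le) // nb_values_le.
Qed.

Lemma sum_by_relabeling (V : nmodType) (X : finType) (c : X -> p.-tuple nat) (F : X -> V) :
  (forall x, canonical_seq (c x)) ->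
  \sum_x F x = \sum_(b <- canonical_list) \sum_(x | c x == b) F x.
Proof.
move=> cc; under [RHS]eq_bigr do rewrite big_mkcond /=.
rewrite [RHS]exchange_big /=; apply: eq_bigr => x _; rewrite -big_mkcond /=.
have xin : c x \in canonical_list by apply/mem_canonical_list.
rewrite (eq_bigl (fun b => b == c x)) => [|b]; last exact: eq_sym.
by rewrite big_pred1_uniq ?canonical_list_uniq // xin.
Qed.

(** A canonical sequence belongs to [canonical_seqs1 s p] for at most one [s],
    namely its number of values. *)
Lemma sum_canonical_seqs1 (K : pzRingType) (c : K) (F : p.-tuple nat -> nat -> K) :
  \sum_(1 <= s < p.+1) c ^+ s * (\sum_(a \in canonical_seqs1 s p) F a s) =
  \sum_(b <- canonical_list)
    if `[< exists i, paired_tree i b >] then c ^+ nb_values b * F b (nb_values b) else 0.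
Proof.
have C1E s : canonical_seqs1 s p =
    [set` [seq b <- canonical_list | `[< canonical_seqs1 s p b >]]].
  apply/seteqP; split => b /=; rewrite mem_filter; last by case/andP=> /asboolP.
  move=> H; rewrite asboolT //=; apply/mem_canonical_list.
  by case: H => -[].
transitivity (\sum_(1 <= s < p.+1) \sum_(b <- canonical_list | `[< canonical_seqs1 s p b >])
    c ^+ s * F b s).
  apply: eq_bigr => s _; rewrite -mulr_sumr; congr (_ * _).
  rewrite [in LHS]C1E -fsbig_seq; last exact/filter_uniq/canonical_list_uniq.
  by rewrite big_filter.
rewrite (exchange_big_dep xpredT) //= big_seq [RHS]big_seq; apply: eq_bigr => b.
move=> /mem_canonical_list cb.
have C1b s : `[< canonical_seqs1 s p b >] = (s == nb_values b) && `[< exists i, paired_tree i b >].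
  apply/asboolP/andP => [H|[/eqP-> /asboolP H]]; last exact/(canonical_seqs1P cb).
  have sE : s = nb_values b by case: H => -[].
  by rewrite sE in H *; split => //; apply/asboolP/(canonical_seqs1P cb).
under eq_bigl do rewrite C1b.
case: ifP => _; last by rewrite big_pred0 // => s; rewrite andbF.
rewrite (eq_bigl (pred1 (nb_values b))) => [|s]; last by rewrite andbT.
by rewrite big_pred1_uniq ?iota_uniq // mem_index_iota nb_values_gt0 ltnS nb_values_le.
Qed.

End CanonicalList.

(** * Asymptotics of the canonical classes *)

Section ComplexLimits.
Variables (R : realType) (I : Type) (F : set_system I).
Hypothesis FF : Filter F.

Lemma norm_real_complex (r : R) : `|r%:C| = `|r|%:C :> R[i].
Proof. by rewrite normc_def /= expr0n addr0 sqrtr_sqr. Qed.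

Lemma gt0_complex (e : R[i]) : 0 < e -> exists2 r : R, 0 < r & e = r%:C.
Proof.
move=> e0; have eE : e = (complex.Re e)%:C by rewrite RRe_real // gtr0_real.
by exists (complex.Re e) => //; move: e0; rewrite eE ltcR.
Qed.

Lemma cvg_real_complex (f : I -> R) (l : R) : f x @[x --> F] --> l ->
  ((f x)%:C : R[i]^o) @[x --> F] --> (l%:C : R[i]^o).
Proof.
move=> fl; apply/cvgrPdist_lt => e /gt0_complex[r r0 ->].
have /cvgrPdist_lt/(_ r r0) := fl; apply: filterS => x.
by rewrite -[X in `|X| < r%:C]rmorphB norm_real_complex ltcR.
Qed.

Lemma cvg_complex0 (z : I -> R[i]) (g : I -> R) :
  (\forall x \near F, `|z x| <= (g x)%:C) -> g x @[x --> F] --> (0 : R) ->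
  (z x : R[i]^o) @[x --> F] --> (0 : R[i]^o).
Proof.
move=> zg g0; apply/cvgrPdist_lt => e /gt0_complex[r r0 ->].
have /cvgrPdist_lt/(_ r r0) := g0; apply: filterS2 zg => x zx.
rewrite !sub0r normrN => gx; rewrite normrN; apply: le_lt_trans zx _.
by rewrite ltcR; apply: le_lt_trans (ler_norm _) _.
Qed.

End ComplexLimits.

(** Collects the powers of [n]: [k] from the normalization of the trace, [p * k]
    from the normalization of the vectors, [q * k] from the sum over the
    coordinates. *)
Lemma powers_cancel (K : fieldType) (x : K) (p k q r : nat) : x != 0 -> (q + r = p.+1)%N ->
  (x ^+ k)^-1 * (x^-1 ^+ (p * k) * (x ^+ q) ^+ k) = (x ^+ k)^-1 ^+ r.
Proof.
move=> x0 qr; rewrite [(p * k)%N]mulnC exprM exprVn -exprM [(q * k)%N]mulnC exprM.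
have X0 : x ^+ k != 0 by rewrite expf_neq0.
by rewrite mulrA -exprS -qr exprD mulrAC -exprMn mulVf // expr1n mul1r.
Qed.

Section KernelClassTerm.
Variables (R : realType) (mu : nat -> nat -> R[i]) (tau : nat -> R).
Hypothesis mu00 : mu 0 0 = 1%R.
Hypothesis mu10 : mu 1 0 = 0%R.
Hypothesis mu01 : mu 0 1 = 0%R.
Hypothesis muSS : forall x y, mu x.+1 y.+1 = mu x y.
Hypothesis mu_le1 : forall x y, `|mu x y| <= 1.
Variables (p : nat) (b : p.-tuple nat).
Hypothesis p_gt0 : (0 < p)%N.
Hypothesis cb : canonical_seq b.
Local Notation s := (nb_values b).

(** The contribution to the normalized expected trace of the index choices with
    canonical form [b]. *)
Definition class_term (m n k : nat) : R[i] :=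
  ((n ^ k)%:R)^-1 * \sum_(f : {ffun 'I_p -> 'I_m} | relabeling (nat_tuple f) == b)
    ((\prod_(u < p) tau (f u))%:C * n%:R^-1 ^+ (p * k) *
      (\sum_(io : {ffun 'I_p -> 'I_n}) weight mu f io) ^+ k).

Lemma paired_class_term m n k i : paired_tree i b -> (0 < n)%N -> (0 < m)%N ->
  class_term m n k = ((m%:R / (n ^ k)%:R) ^+ s * (m%:R^-1 ^+ s *
    \sum_(h : {ffun 'I_s -> 'I_m} | injectiveb h) \prod_(t < s) tau (h t) ^+ deg b t.+1))%:C.
Proof.
move=> G n0 m0; rewrite -(sum_canonical_class cb) mulrA.
have nbi : nb_values i = (p.+1 - s)%N.
  by case/and3P: G => _ _ /eqP <-; rewrite addKn.
have sp : (s <= p.+1)%N by rewrite leqW // nb_values_le.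
have nC : n%:R != 0 :> R[i] by rewrite pnatr_eq0 -lt0n.
have mR : m%:R != 0 :> R by rewrite pnatr_eq0 -lt0n.
rewrite -exprMn mulrAC mulfV // mul1r.
rewrite rmorphM rmorph_sum /= mulr_sumr /class_term mulr_sumr.
apply: eq_bigr => f /eqP fb.
have Gf : paired_tree i (nat_tuple f).
  by apply: paired_tree_same_kernel G => //; apply: same_kernel_of_relabeling.
rewrite (sum_weight_paired_tree n p_gt0 mu00 mu10 muSS Gf) nbi.
rewrite [((_)^-1 ^+ s)%:C]rmorphXn /= fmorphV rmorph_nat natrX.
by rewrite -!mulrA mulrCA (powers_cancel k nC (subnK sp)) mulrC.
Qed.

(** Same power count as in [paired_class_term], with one coordinate less to sum
    over in each of the [k] factors; this leaves the last factor. *)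
Lemma unpaired_class_term m n k : ~ (exists i, paired_tree i b) -> (0 < n)%N -> (0 < m)%N ->
  `|class_term m n k| <= ((m%:R / (n ^ k)%:R) ^+ s * (m%:R^-1 ^+ s *
    \sum_(h : {ffun 'I_s -> 'I_m}) \prod_(t < s) `|tau (h t)| ^+ deg b t.+1) *
    ((p ^ p)%:R / n%:R) ^+ k)%:C.
Proof.
move=> nG n0 m0.
have sp : (p - s + s.+1 = p.+1)%N by rewrite addnS subnK // nb_values_le.
have nR : n%:R != 0 :> R by rewrite pnatr_eq0 -lt0n.
have mR : m%:R != 0 :> R by rewrite pnatr_eq0 -lt0n.
have cancel_m (t : R) : (m%:R / (n ^ k)%:R) ^+ s * (m%:R^-1 ^+ s * t) = (n ^ k)%:R^-1 ^+ s * t.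
  by rewrite mulrA -exprMn mulrAC mulfV // mul1r.
rewrite cancel_m.
pose S : R := \sum_(f : {ffun 'I_p -> 'I_m} | relabeling (nat_tuple f) == b)
  \prod_(u < p) `|tau (f u)|.
have S_le : S <= \sum_(h : {ffun 'I_s -> 'I_m}) \prod_(t < s) `|tau (h t)| ^+ deg b t.+1.
  rewrite /S (sum_canonical_class cb (fun j => `|tau j|)) big_mkcond /=.
  apply: ler_sum => h _; case: ifP => // _.
  by apply: prodr_ge0 => t _; rewrite exprn_ge0.
have ni0 : 0 <= n%:R^-1 :> R by rewrite invr_ge0 ler0n.
have Xi0 : 0 <= (n ^ k)%:R^-1 :> R by rewrite invr_ge0 ler0n.
apply: (@le_trans _ _ ((n ^ k)%:R^-1 ^+ s * S * ((p ^ p)%:R / n%:R) ^+ k)%:C); last first.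
  by rewrite lecR ler_wpM2r ?exprn_ge0 ?divr_ge0 ?ler0n // ler_wpM2l // exprn_ge0.
have -> : (n ^ k)%:R^-1 ^+ s * S * ((p ^ p)%:R / n%:R) ^+ k =
  (n ^ k)%:R^-1 * (S * (n%:R^-1 ^+ (p * k) * ((p ^ p * n ^ (p - s))%:R ^+ k))).
  rewrite [(p ^ p * _)%:R]natrM !exprMn [(n ^ (p - s))%:R]natrX.
  rewrite (_ : (n ^ k)%:R^-1 * _ = S * (p ^ p)%:R ^+ k * ((n ^ k)%:R^-1 *
     (n%:R^-1 ^+ (p * k) * (n%:R ^+ (p - s)) ^+ k))); last by ring.
  rewrite natrX (powers_cancel k nR sp) exprSr exprVn [n%:R^-1 ^+ k]exprVn.
  by ring.
rewrite /class_term normrM rmorphM /=; apply: ler_pM => //.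
  by rewrite normfV normr_nat fmorphV rmorph_nat.
apply: le_trans (ler_norm_sum _ _ _) _.
rewrite rmorphM rmorph_sum /= mulr_suml; apply: ler_sum => f /eqP fb.
rewrite !normrM norm_real_complex normr_prod -mulrA.
apply: ler_wpM2l; first by rewrite ler0c prodr_ge0.
rewrite rmorphM /=; apply: ler_pM => //.
  by rewrite normrX normfV normr_nat rmorphXn /= fmorphV rmorph_nat.
rewrite normrX rmorphXn /= rmorph_nat; apply: lerXn2r; rewrite ?nnegrE ?ler0n //.
have ker : same_kernel b (nat_tuple f) by apply: same_kernel_of_relabeling.
rewrite (nb_values_same_kernel ker); apply: norm_sum_weight_le => //.
move=> [i G]; apply: nG; exists i; apply: paired_tree_same_kernel G => // u v.
Qed.

End KernelClassTerm.

Theorem theorem1p1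
  (R : realType)
  (* the entry law: a centered unit-variance complex variable with |xi1| = 1 *)
  (d0 : measure_display) (T0 : measurableType d0) (P0 : probability T0 R)
  (xi1 : T0 -> R[i])
  (hxi1 : complex_RV xi1)
  (hcentered : complex_expectation P0 xi1 = 0)
  (hvariance : complex_variance P0 xi1 = 1)
  (hmod : \forall w \ae P0, `|xi1 w| = 1)
  (* the fixed real sequence tau and the limits of its empirical moments *)
  (tau : nat -> R) (mtau : nat -> R)
  (htau : forall q : nat, (0 < q)%N ->
     (fun m : nat => m%:R^-1 * \sum_(j < m) tau j ^+ q) @ \oo --> mtau q)
  (* m, n, k tend to infinity along F with m / n^k -> c *)
  (I : Type) (F : set_system I) (FF : ProperFilter F)
  (n k m : I -> nat)
  (hn : n @ F --> \oo) (hk : k @ F --> \oo) (hm : m @ F --> \oo)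
  (c : R) (hc : 0 < c)
  (hratio : (fun i => (m i)%:R / (n i ^ k i)%:R : R) @ F --> c)
  (* xi i a l j: coordinate j of sqrt(n) * y_a^(l), i.i.d. copies of xi1 *)
  (d : I -> measure_display) (T : forall i, measurableType (d i))
  (P : forall i, probability (T i) R)
  (xi : forall i, 'I_(m i) -> 'I_(k i) -> 'I_(n i) -> T i -> R[i])
  (hxi : forall i a l j, complex_RV (xi i a l j))
  (hlaw : forall i a l j, same_law (P i) (xi i a l j) P0 xi1)
  (hindep : forall i, mutually_independent (P i)
     (fun u : 'I_(m i) * 'I_(k i) * 'I_(n i) => xi i u.1.1 u.1.2 u.2))
  (p : nat) (hp : (1 <= p)%N) :
  (fun i => ((n i ^ k i)%:R)^-1 *
     complex_expectation (P i) (fun w =>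
       \tr (tensor_matrix tau (fun a l j => xi i a l j w) ^+ p)) : R[i]^o) @ F -->
  ((\sum_(1 <= s < p.+1) c ^+ s *
     \sum_(a \in canonical_seqs1 s p) \prod_(1 <= t < s.+1) mtau (deg a t))%:C
   : R[i]^o).
Proof.
pose mu := entry_moment P0 xi1.
have mu00 : mu 0 0 = 1 := entry_moment00 P0 xi1.
have mu01 : mu 0 1 = 0 := entry_moment01 hxi1 hcentered hmod.
have mu10 : mu 1 0 = 0 := entry_moment10 hxi1 hcentered hmod.
have muSS x y : mu x.+1 y.+1 = mu x y := entry_momentSS P0 xi1 x y.
have mu_le1 x y : `|mu x y| <= 1 := entry_moment_le1 P0 hxi1 x y.
have n_large N : \forall i \near F, (N <= n i)%N by exact: (hn _ (nbhs_infty_ge N)).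
have k_pos : \forall i \near F, (0 < k i)%N by exact: (hk _ (nbhs_infty_ge 1)).
have m_pos : \forall i \near F, (0 < m i)%N by exact: (hm _ (nbhs_infty_ge 1)).
pose term (b : p.-tuple nat) i := class_term mu tau b (m i) (n i) (k i).
have trE i : ((n i ^ k i)%:R)^-1 * complex_expectation (P i) (fun w =>
    \tr (tensor_matrix tau (fun a l j => xi i a l j w) ^+ p)) =
  \sum_(b <- canonical_list p) term b i.
  rewrite (expectation_trace hxi1 hmod tau hp (hxi i) (hlaw i) (hindep i)).
  rewrite (sum_by_relabeling (c := fun f => relabeling (nat_tuple f))); last first.
    by move=> f; apply: canonical_relabeling.
  by rewrite mulr_sumr.
have -> : (fun i => ((n i ^ k i)%:R)^-1 * complex_expectation (P i) (fun w =>
    \tr (tensor_matrix tau (fun a l j => xi i a l j w) ^+ p)) : R[i]^o) =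
  (fun i => \sum_(b <- canonical_list p) (term b i : R[i]^o)).
  by apply/funext => i; rewrite trE.
rewrite (sum_canonical_seqs1 hp c (fun a s => \prod_(1 <= t < s.+1) mtau (deg a t))).
rewrite rmorph_sum /=; apply: cvg_sum_seq => b /mem_canonical_list cb.
have deg0 := deg_canonical_gt0 cb.
have ratio_cvg : ((m i)%:R / (n i ^ k i)%:R) ^+ nb_values b @[i --> F] --> c ^+ nb_values b.
  elim: (nb_values b) => [|q IH]; first by under eq_fun do rewrite expr0; apply: cvg_cst.
  by under eq_fun do rewrite exprS; rewrite exprS; apply: cvgM.
case: asboolP => [[i0 G]|nG].
  rewrite big_add1 /= big_mkord.
  pose inj_sum M := M%:R^-1 ^+ nb_values b * \sum_(h : {ffun 'I_(nb_values b) -> 'I_M} |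
    injectiveb h) \prod_t tau (h t) ^+ deg b t.+1.
  have inj_cvg : inj_sum (m i) @[i --> F] --> \prod_(t < nb_values b) mtau (deg b t.+1).
    exact: (cvg_comp _ _ hm (cvg_injective_sum htau deg0)).
  apply: cvg_trans (cvg_real_complex _ (cvgM ratio_cvg inj_cvg)).
  apply: near_eq_cvg; near=> i.
  rewrite /term (paired_class_term tau mu00 mu10 muSS hp cb _ G) //.
    by near: i; apply: n_large.
  by near: i; apply: m_pos.
have [B B0 BM] := abs_sum_bounded htau deg0.
have ninv : ((n i)%:R^-1 : R) @[i --> F] --> (0 : R).
  exact: (cvg_comp _ _ hn (@cvg_invn R)).
rewrite rmorph0.
apply: (@cvg_complex0 _ _ _ _ _ (fun i => ((m i)%:R / (n i ^ k i)%:R) ^+ nb_values b *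
    (B * ((p ^ p)%:R * (n i)%:R^-1)))).
  near=> i.
  have ni0 : (0 < n i)%N by near: i; apply: n_large.
  have mi0 : (0 < m i)%N by near: i; apply: m_pos.
  have ki0 : (0 < k i)%N by near: i; apply: k_pos.
  (* Then [p ^ p / n i <= 1], and its [k i]-th power is at most itself. *)
  have np : (p ^ p <= n i)%N by near: i; apply: n_large.
  have bt := unpaired_class_term tau mu10 mu01 mu_le1 hp cb (k i) nG ni0 mi0.
  apply: le_trans bt _.
  rewrite lecR -mulrA; apply: ler_wpM2l; first by rewrite exprn_ge0 // divr_ge0 ?ler0n.
  have q0 : 0 <= (p ^ p)%:R / (n i)%:R :> R by rewrite divr_ge0 ?ler0n.
  apply: ler_pM => //.
  - by rewrite mulr_ge0 ?exprn_ge0 ?invr_ge0 ?ler0n // sumr_ge0 // => h _; rewrite prodr_ge0.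
  - rewrite -[leRHS]expr1; apply: ler_wiXn2l => //.
    by rewrite ler_pdivrMr ?ltr0n // mul1r ler_nat.
rewrite -[X in _ --> X](mulr0 (c ^+ nb_values b)); apply: cvgM ratio_cvg _.
rewrite -[X in _ --> X](mulr0 B); apply: cvgM; first exact: cvg_cst.
by rewrite -[X in _ --> X](mulr0 (p ^ p)%:R); apply: cvgM; first exact: cvg_cst.
Unshelve. all: by end_near.
Qed.
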